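(* Consider the parallel-server system with cancel-on-completion redundancy described in the context, with $N$ servers, $M$ job types and service speeds $r_{ij}>0$ for all $i=1,\dots,N$, $j=1,\dots,M$. Suppose that job types are known and that replicas are identical, i.e. for every job type $j$ the speed variation is deterministic, $S_j\equiv c_j$ with $c_j\in\mathbb{R}_{+}$. Then for every $d$ with $1<d\le N$ the stability region for $d=1$ is strictly larger than the stability region for $d$ replicas, where in both cases replicas are assigned by static probabilistic assignment policies (which may depend on the job type).
   Context: **System.** There are $N$ parallel servers, each with its own queue and a first-come-first-served (FCFS) discipline. Jobs arrive as a Poisson process of rate $\lambda$. Each job is independently of type $j\in\{1,\dots,M\}$ with probability $p_j>0$, $\sum_j p_j=1$. A type-$j$ job has a random intrinsic size distributed as $X_j$, and on server $i$ it has service speed $r_{ij}$ and random speed variation $Y_{ij}$, where $Y_{1j},\dots,Y_{Nj}$ have the distribution of a generic nonnegative random variable $S_j$. The processing time of a replica of the job at server $i$ is $X_jY_{ij}/r_{ij}$. The intrinsic size is independent of the speed variations, and the sizes and speed variations of different jobs are independent of each other and of the arrivals. The means $\mathbb{E}[X_j]$ and $\mathbb{E}[S_j]$ are finite and positive. **Redundancy, cancel-on-completion (c.o.c.).** Upon arrival, a job is immediately replicated to $d$ distinct servers and a replica joins the FCFS queue of each of these servers. As soon as the first replica of the job completes service, all its remaining replicas are abandoned (removed from queue or service). For $d=1$ there is no replication. **Static probabilistic assignment, known job types.** The dispatcher observes the type of each arriving job. A static policy with $d$ replicas is given by probabilities $q_j(I)\ge 0$, for each type $j$ and each set $I$ of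 $d$ servers, with $\sum_I q_j(I)=1$; each arriving type-$j$ job is assigned to $I$ with probability $q_j(I)$, independently of everything else. **Stability.** Stability of the system under a given policy is meant in the usual queueing sense (positive recurrence/existence of a stationary regime); in a stable system the long-term fraction of time that each server is busy exists and is strictly less than $1$. The stability region for $d$ replicas is the set of all $\lambda\ge 0$ for which there exists a static probabilistic assignment policy with $d$ replicas under which the system is stable. For $d=1$ it equals $$\Big\{\lambda\ge 0 : \exists\,\tilde p_{ij}\ge 0,\ \sum_{i=1}^N\tilde p_{ij}=1\ \forall j,\ \ \lambda\sum_{j=1}^M\tilde p_{ij}p_j\frac{\mathbb{E}[X_j]\mathbb{E}[S_j]}{r_{ij}}<1\ \forall i\Big\}.$$ ''Strictly larger'' means that it strictly contains the other region. *)

(* Defs.v *)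
(* MathComp / MathComp-Analysis *)
From HB Require Import structures.
From mathcomp Require Import all_boot all_order all_algebra.
From mathcomp Require Import all_classical all_reals all_analysis.

Set Implicit Arguments.
Unset Strict Implicit.
Unset Printing Implicit Defensive.

Import Order.TTheory GRing.Theory Num.Theory.
Import numFieldNormedType.Exports.

Local Open Scope classical_set_scope.
Local Open Scope ring_scope.

(* Mutual independence of the families of events [F k], k : K.  Every finite
   subfamily is listed without repetition by some injective [k]. *)
Definition mutually_independent (dT : measure_display) (T : measurableType dT)
    (R : realType) (P : probability T R) (K : Type)
    (F : K -> set (set T)) : Prop :=
  forall (m : nat) (k : 'I_m -> K) (A : 'I_m -> set T),
    injective k -> (forall i, F (k i) (A i)) ->
    P (\bigcap_i A i) = (\prod_(i < m) P (A i))%E.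

Definition generated_by (dT : measure_display) (T : measurableType dT)
    (R : realType) (K : Type) (f : K -> T -> R) : set (set T) :=
  <<s [set A | exists k (B : set R), measurable B /\ A = f k @^-1` B] >>.

(* The law of a nonnegative random variable with finite positive mean. *)
Definition positive_mean_law (R : realType)
    (mu : probability R R) : Prop :=
  mu `[0, +oo[%classic = 1%E /\ (0 < \int[mu]_x x%:E < +oo)%E.

(** * Primitive random data *)

(* Job n = 0, 1, 2, ... (in order of arrival) carries:
   - a standard exponential variable; the arrival process of rate lam is
     obtained by dividing all of these by lam, so that the same data serve for
     every lam > 0;
   - its type;
   - for each type j, the intrinsic size that it has if it is of type j;
   - for each server i and type j, the speed variation that it has at server i
     if it is of type j (no joint law across servers is imposed);
   - a uniform variable, with which the dispatcher draws the set of servers. *)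
Record primitives (dT : measure_display) (T : measurableType dT)
    (R : realType) (P : probability T R) (N M : nat) := Primitives {
  unit_interarrival : nat -> {RV P >-> R};
  job_type : nat -> T -> 'I_M;
  job_size : nat -> 'I_M -> {RV P >-> R};
  variation : nat -> 'I_N -> 'I_M -> {RV P >-> R};
  dispatch_mark : nat -> {RV P >-> R}
}.

Variant source := Interarrival | JobType | JobSize | Variation | DispatchMark.

Definition source_events (dT : measure_display) (T : measurableType dT)
    (R : realType) (P : probability T R) (N M : nat)
    (X : primitives P N M) (ns : nat * source) : set (set T) :=
  let n := ns.1 in
  match ns.2 with
  | Interarrival => generated_by (fun _ : unit => unit_interarrival X n)
  | JobType => [set A | exists B : set 'I_M, A = job_type X n @^-1` B]
  | JobSize => generated_by (job_size X n)
  | Variation =>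
      generated_by (fun ij : 'I_N * 'I_M => variation X n ij.1 ij.2)
  | DispatchMark => generated_by (fun _ : unit => dispatch_mark X n)
  end.

Record primitives_law (dT : measure_display) (T : measurableType dT)
    (R : realType) (P : probability T R) (N M : nat) (X : primitives P N M)
    (p : 'I_M -> R) (lawX lawS : 'I_M -> probability R R)
    : Prop := {
  unit_interarrival_law : forall n (B : set R), measurable B ->
    distribution P (unit_interarrival X n) B = exponential_prob 1 B;
  job_type_measurable : forall n j, measurable (job_type X n @^-1` [set j]);
  job_type_law : forall n j, P (job_type X n @^-1` [set j]) = (p j)%:E;
  job_size_law : forall n j (B : set R), measurable B ->
    distribution P (job_size X n j) B = lawX j B;
  variation_law : forall n i j (B : set R), measurable B ->
    distribution P (variation X n i j) B = lawS j B;
  dispatch_mark_law : forall n (B : set R), measurable B ->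
    distribution P (dispatch_mark X n) B = uniform_prob (@ltr01 R) B;
  primitives_independent : mutually_independent P (source_events X)
}.

(** * Sample paths: FCFS queues with cancellation on completion *)

(* A job arriving at time [a], replicated on the servers of [I] with processing
   times [b i], where all earlier jobs have left the queue of server [i] at time
   [f i]: its replica at [i] starts at max(a, f i) unless cancelled before, and
   the whole job leaves when the first replica completes.  The set is finite,
   and nonempty unless [I] is. *)
Definition first_completion (R : realType) (N : nat) (a : R) (f : 'I_N -> R)
    (I : {set 'I_N}) (b : 'I_N -> R) : R :=
  inf [set Num.max a (f i) + b i | i in [set i | i \in I]].

(* [clear_time A I B n i]: the first time from which no replica of the jobs
   0, ..., n-1 is present at server i, for arrival times [A n], assigned sets
   [I n] and processing times [B n i]. *)
Fixpoint clear_time (R : realType) (N : nat) (A : nat -> R)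
    (I : nat -> {set 'I_N}) (B : nat -> 'I_N -> R) (n : nat) (i : 'I_N) : R :=
  if n is m.+1 then
    let f := clear_time A I B m in
    if i \in I m then Num.max (f i) (first_completion (A m) f (I m) (B m))
    else f i
  else 0.

Definition departure (R : realType) (N : nat) (A : nat -> R)
    (I : nat -> {set 'I_N}) (B : nat -> 'I_N -> R) (n : nat) : R :=
  first_completion (A n) (clear_time A I B n) (I n) (B n).

Definition finds_empty (R : realType) (N : nat) (A : nat -> R)
    (I : nat -> {set 'I_N}) (B : nat -> 'I_N -> R) (n : nat) : Prop :=
  forall m, (m < n)%N -> departure A I B m <= A n.

(* Time from the arrival of job 0, which finds the system empty, to the next
   arrival that finds the system empty; +oo if there is none. *)
Definition cycle_length (R : realType) (N : nat) (A : nat -> R)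
    (I : nat -> {set 'I_N}) (B : nat -> 'I_N -> R) : \bar R :=
  ereal_inf [set (A n - A 0%N)%:E
            | n in [set n | (0 < n)%N /\ finds_empty A I B n]].

(** * Static probabilistic assignment with known types *)

Definition static_policy (R : realType) (N M d : nat)
    (q : 'I_M -> {set 'I_N} -> R) : Prop :=
  [/\ forall j I, 0 <= q j I,
      forall j (I : {set 'I_N}), #|I| != d -> q j I = 0
    & forall j, \sum_(I : {set 'I_N}) q j I = 1].

(* Inverse transform sampling: for [u] uniform on [0, 1] and [w] a probability
   vector on the duplicate-free list [s], the result is [x] with probability
   [w x] (the default [x0] is only reached on a null event). *)
Fixpoint sample (R : realType) (U : Type) (x0 : U) (w : U -> R) (s : seq U)
    (u : R) : U :=
  if s is x :: s' then if u < w x then x else sample x0 w s' (u - w x) else x0.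

(** * The system driven by the primitive data *)

Definition arrival_time (dT : measure_display) (T : measurableType dT)
    (R : realType) (P : probability T R) (N M : nat) (X : primitives P N M)
    (lam : R) (t : T) (n : nat) : R :=
  \sum_(k < n.+1) unit_interarrival X k t / lam.

Definition assigned_set (dT : measure_display) (T : measurableType dT)
    (R : realType) (P : probability T R) (N M : nat) (X : primitives P N M)
    (q : 'I_M -> {set 'I_N} -> R) (t : T) (n : nat) : {set 'I_N} :=
  sample (finset.set0 : {set _}) (q (job_type X n t)) (enum {: {set 'I_N}}) (dispatch_mark X n t).

Definition processing_time (dT : measure_display) (T : measurableType dT)
    (R : realType) (P : probability T R) (N M : nat) (X : primitives P N M)
    (r : 'I_N -> 'I_M -> R) (t : T) (n : nat) (i : 'I_N) : R :=
  let j := job_type X n t in job_size X n j t * variation X n i j t / r i j.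

(* The system regenerates at the arrivals that find it empty, so that positive
   recurrence means that the regeneration cycles have finite mean.  As the
   interarrival times are exponential, hence unbounded, a system with a
   stationary regime does empty, and the two notions agree.  With lam = 0 there
   are no arrivals and the system is always empty. *)
Definition stable (dT : measure_display) (T : measurableType dT)
    (R : realType) (P : probability T R) (N M : nat) (X : primitives P N M)
    (r : 'I_N -> 'I_M -> R) (q : 'I_M -> {set 'I_N} -> R) (lam : R) : Prop :=
  lam = 0 \/
  (\int[P]_t cycle_length (arrival_time X lam t) (assigned_set X q t)
               (processing_time X r t) < +oo)%E.

Definition stability_region (dT : measure_display) (T : measurableType dT)
    (R : realType) (P : probability T R) (N M : nat) (X : primitives P N M)
    (r : 'I_N -> 'I_M -> R) (d : nat) : set R :=
  [set lam | 0 <= lam /\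
     exists q : 'I_M -> {set 'I_N} -> R,
       static_policy d q /\ stable X r q lam].

(* Main.v *)
Require Import Defs.
From HB Require Import structures.
From mathcomp Require Import all_boot all_order all_algebra.
From mathcomp Require Import all_classical all_reals all_analysis.
From mathcomp Require Import measurable_realfun ring lra.
Import Order.TTheory GRing.Theory Num.Theory.
Import numFieldNormedType.Exports.
Local Open Scope classical_set_scope.
Local Open Scope ring_scope.
Set Implicit Arguments.
Unset Strict Implicit.
Unset Printing Implicit Defensive.

(* Replication wastes capacity.  With identical replicas a job brings the work
   [X_j c_j / r_ij] to the server [i] that completes it, whatever happens
   elsewhere, so the size-weighted frequencies with which the servers complete
   the type-[j] jobs over a regeneration cycle define a static policy without
   replication under which no server has more load.  Moreover the oldest job
   present is always in service at all its [d >= 2] servers, so one server's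
   worth of capacity is lost whenever the system is busy; this slack can be
   shared between the servers, all the [r_ij] being positive, and every arrival
   rate that is stable with [d] replicas can be raised by a fixed factor.

   Conversely, a policy without replication whose loads are all below one is
   stable.  The workloads found by the arrivals are reflected random walks with
   negative drift, driven by common interarrival times.  Sizes have only a first
   moment, so the drift of the Huber function of a workload is used instead of
   that of its square, along the process killed at the end of the cycle: of the
   arrivals in a cycle at most half, in the mean, find a large workload at some
   server, while from moderate workloads the cycle ends with a probability
   bounded below. *)

(** * Independence of the past and the next source *)

(** Both directions turn on the events that job [n] still belongs to the cycle of job 0. Such an
    event is settled when job [n] arrives, before the type, size and mark of that job and the next
    gap are drawn. Products of means with these events take the place of conditional expectations
    and stopping times, and the sum of their probabilities is the mean number of jobs in a cycle.
    The upper half of Wald's identity bounds the mean cycle length by this sum. For the replicated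
    system the bound is read backwards, at a finite horizon; this costs a factor arbitrarily close
    to 1, which the slack of the lost server absorbs.

    Strictness does not come from exhibiting a rate that fails with [d] replicas. If the regions
    coincided, the common region would contain a positive rate and with it all its multiples by
    powers of a fixed factor above 1, while the loads keep the region of [d] replicas bounded. *)

Section independent_sequence.
Context (R : realType) (dT : measure_display) (T : measurableType dT).
Variables (P : probability T R) (F : nat -> set (set T)).
Hypothesis F_meas : forall c, F c `<=` measurable.
Hypothesis F_setI : forall c, setI_closed (F c).
Hypothesis F_setT : forall c, F c setT.
Hypothesis F_ind : mutually_independent P F.

Definition past_gen (c : nat) : set (set T) :=
  [set A | exists2 k, (k < c)%N & F k A].

(** A pi-system that generates the past and about which mutual independence speaks directly; an
    unconstrained coordinate is [setT]. *)
Definition past_box (c : nat) : set (set T) :=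
  [set A | exists2 B : nat -> set T, (forall k, F k (B k)) &
     A = \bigcap_(i in [set: 'I_c]) B i].

Lemma past_gen_measurable c A : <<s past_gen c >> A -> measurable A.
Proof.
apply: smallest_sub; first exact: sigma_algebra_measurable.
by move=> B [k _ /F_meas].
Qed.

Lemma past_box_generates c A : <<s past_gen c >> A -> <<s past_box c >> A.
Proof.
apply: smallest_sub; first exact: smallest_sigma_algebra.
move=> B [k kc FB]; apply: sub_sigma_algebra.
exists (fun i => if i == k then B else setT).
  by move=> i; case: eqP => [->|].
apply/seteqP; split=> [x Bx i _|x /(_ (Ordinal kc) I)] /=; last by rewrite eqxx.
by case: eqP.
Qed.

(** Two finite measures of [A], the mass of its intersection with [B] and [P A * P B], agree on
    boxes, hence on the sigma-algebra that the boxes generate. *)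
Lemma indep_past c A B : <<s past_gen c >> A -> F c B ->
  P (A `&` B) = (P A * P B)%E.
Proof.
move=> sA FB.
have mB : measurable B by exact: F_meas FB.
have PBfin : P B \is a fin_num by rewrite fin_num_measure.
have PB0 : 0 <= fine (P B) by rewrite fine_ge0.
pose r : {nonneg R} := NngNum PB0.
rewrite -(fineK PBfin) muleC.
apply: (@g_sigma_algebra_measure_unique _ _ _ (past_box c) _ (fun=> setT) _ _
   (mrestr P mB) (mscale r P) _ _ _ A) => //.
- move=> C [D FD ->]; apply: fin_bigcap_measurable => // i _; exact: F_meas.
- by move=> _; exists (fun=> setT) => //; apply/seteqP; split.
- by apply/seteqP; split => // x _; exists 0%N.
- move=> C D [C' FC ->] [D' FD ->]; exists (fun i => C' i `&` D' i).
    by move=> k; exact: F_setI.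
  by rewrite bigcapI.
- move=> C [D FD ->]; rewrite /mrestr /mscale /=.
  (* The box and [B] form one family over ['I_c.+1], with [B] at the last index. *)
  have := @F_ind c.+1 (fun i : 'I_c.+1 => i : nat)
     (fun i => if i == ord_max then B else D i).
  rewrite big_ord_recr /= eqxx => H.
  transitivity ((\prod_(i < c) P (D i)) * P B)%E.
    have {}H : P (\bigcap_i (if i == ord_max :> 'I_c.+1 then B else D i)) =
      ((\prod_(i < c) P (if widen_ord (leqnSn c) i == ord_max then B
         else D i)) * P B)%E.
      apply: H; first exact: ord_inj.
      by move=> i; case: eqP => [->|].
    transitivity (P (\bigcap_i (if i == ord_max :> 'I_c.+1 then B else D i))).
      congr (P _); apply/seteqP; split => [x [Dx Bx] i _|x Hx].
        case: eqP => // /eqP ic.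
        have ltic : (i < c)%N.
          by move: (ltn_ord i); rewrite ltnS leq_eqVlt => /orP[/eqP e|//];
            move: ic; rewrite -val_eqE /= e eqxx.
        exact: (Dx (Ordinal ltic)).
      split; last by have := Hx ord_max I; rewrite eqxx.
      move=> i _; have := Hx (widen_ord (leqnSn c) i) I.
      by rewrite -val_eqE /= ltn_eqF.
    rewrite {}H; congr (_ * _)%E; apply: eq_bigr => i _.
    by rewrite -val_eqE /= ltn_eqF.
  transitivity (P B * P (\bigcap_i D (i : 'I_c)))%E; last by rewrite -{1}(fineK PBfin).
  rewrite muleC; congr (_ * _)%E; apply/esym.
  apply: F_ind; [exact: ord_inj|by move=> i; exact: FD].
- by move=> k; rewrite /= /mrestr setTI -ge0_fin_numE.
- exact: past_box_generates.
Qed.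

(** The same points with a smaller sigma-algebra: being known in the past becomes plain
    measurability, and the closure properties of measurable functions carry over. *)
Definition pastT c := g_sigma_algebraType (past_gen c).

Definition adapted c d' (T' : measurableType d') (f : T -> T') :=
  @measurable_fun _ _ (pastT c) T' setT f.

Lemma past_gen_mono c c' A : (c <= c')%N ->
  <<s past_gen c >> A -> <<s past_gen c' >> A.
Proof.
move=> cc'; apply: smallest_sub; first exact: smallest_sigma_algebra.
by move=> B [k kc FB]; apply: sub_sigma_algebra; exists k => //; exact: leq_trans cc'.
Qed.

Lemma adapted_mono c c' d' (T' : measurableType d') (f : T -> T') :
  (c <= c')%N -> adapted c f -> adapted c' f.
Proof.
move=> cc' af _ B mB; apply: (past_gen_mono cc'); exact: af.
Qed.

Lemma adapted_measurable c d' (T' : measurableType d') (f : T -> T') :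
  adapted c f -> measurable_fun setT f.
Proof. by move=> af _ B mB; apply: past_gen_measurable; exact: af. Qed.

Lemma adapted_gen c d' (T' : measurableType d') (f : T -> T') :
  (forall B, measurable B -> F c (f @^-1` B)) -> adapted c.+1 f.
Proof.
move=> fF _ B mB; apply: sub_sigma_algebra; exists c => //.
by rewrite setTI; exact: fF.
Qed.

(** Independence makes the law of the pair a product measure, and Tonelli's theorem applies without
    any integrability. *)
Lemma expectation_prod c (Z Y : T -> R) : adapted c Z ->
  (forall B, measurable B -> F c (Y @^-1` B)) ->
  (forall t, 0 <= Z t) -> (forall t, 0 <= Y t) ->
  (\int[P]_t (Z t * Y t)%:E = \int[P]_t (Z t)%:E * \int[P]_t (Y t)%:E)%E.
Proof.
move=> aZ FY Z0 Y0.
have mZ : measurable_fun setT Z by exact: adapted_measurable aZ.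
have mY : measurable_fun setT Y.
  by apply: (@adapted_measurable c.+1); exact: adapted_gen.
pose Zm : {mfun T >-> R} := HB.pack Z (isMeasurableFun.Build _ _ _ _ _ mZ).
pose Ym : {mfun T >-> R} := HB.pack Y (isMeasurableFun.Build _ _ _ _ _ mY).
have mZY : measurable_fun setT (fun t => (Z t, Y t)) by exact: measurable_fun_pair.
pose ZYm : {mfun T >-> (R * R)%type} := HB.pack (fun t => (Z t, Y t))
   (isMeasurableFun.Build _ _ _ _ _ mZY).
(* Tonelli's theorem asks for an integrand that is nonnegative on the whole plane, not only at the
   values of the pair. *)
pose h (x : R) : \bar R := (Num.max 0 x)%:E.
have mh : measurable_fun [set: R] h.
  by apply/measurable_EFinP; apply: measurable_maxr => //; exact: measurable_cst.
have h0 x : (0 <= h x)%E by rewrite lee_fin le_max lexx.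
have mh2 : measurable_fun [set: R * R] (fun z : R * R => h z.1 * h z.2)%E.
  by apply: emeasurable_funM; apply: (measurableT_comp mh).
have distE : forall X, measurable X ->
    (distribution P Zm \x distribution P Ym)%E X = distribution P ZYm X.
  apply: product_measure_unique => A B mA mB.
  rewrite /distribution /pushforward /=.
  apply: (@indep_past c (Z @^-1` A) (Y @^-1` B)); last exact: FY.
  by rewrite -[X in <<s _ >> X]setTI; exact: aZ.
transitivity (\int[distribution P ZYm]_z (h z.1 * h z.2))%E.
  rewrite ge0_integral_distribution//; last by move=> z; rewrite mule_ge0.
  by apply: eq_integral => t _ /=; rewrite /h !(max_r (Z0 _), max_r (Y0 _)) EFinM.
rewrite -(eq_measure_integral _ (fun X mX _ => distE X mX)).
rewrite fubini_tonelli1//=; last by move=> z; rewrite mule_ge0.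
rewrite /fubini_F /=.
under eq_integral => x _ do rewrite ge0_integralZl//.
have hY0 : (0 <= \int[distribution P Ym]_y h y)%E by exact: integral_ge0.
rewrite ge0_integralZr// !ge0_integral_distribution//.
by congr (_ * _)%E; apply: eq_integral => t _ /=; rewrite /h max_r.
Qed.

End independent_sequence.

(** * Sample paths *)

Section sample_path.
Context (R : realType) (N : nat).
Variables (A : nat -> R) (I : nat -> {set 'I_N}) (B : nat -> 'I_N -> R).

Lemma first_completion_attained (a : R) (f : 'I_N -> R) (J : {set 'I_N})
    (b : 'I_N -> R) :
  J != finset.set0 -> (exists2 i, i \in J & first_completion a f J b = Num.max a (f i) + b i) /\
  (forall i, i \in J -> first_completion a f J b <= Num.max a (f i) + b i).
Proof.
move=> /set0Pn[i0 Ji0]; rewrite /first_completion.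
set S := [set _ | _ in _].
pose F i := Num.max a (f i) + b i.
have [i1 Ji1 Hi1] : exists2 i1, i1 \in J & forall i, i \in J -> F i1 <= F i.
  by case: (@arg_minP _ _ _ i0 (mem J) F) => // i1 ? ?; exists i1.
have lbS : lbound S (F i1) by move=> _ [i Ji <-]; exact: Hi1.
have infS : inf S = F i1.
  apply/eqP; rewrite eq_le; apply/andP; split.
    by apply: ge_inf; [exists (F i1)|exists i1].
  by apply: lb_le_inf => //; exists (F i1); exists i1.
by rewrite infS; split; [exists i1|].
Qed.

Local Notation f := (clear_time A I B).
Local Notation D := (departure A I B).

Definition completes_first (n : nat) (i : 'I_N) : bool :=
  (i \in I n) && (D n == Num.max (A n) (f n i) + B n i).

(* Ties between replicas are broken by the server index. *)
Definition completes_at (n : nat) (i : 'I_N) : bool :=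
  completes_first n i && [forall k : 'I_N, (k < i)%N ==> ~~ completes_first n k].

(** Each job is credited to exactly one server, which is what turns credited frequencies into
    probabilities. *)
Lemma completes_at_sum (n : nat) : I n != finset.set0 ->
  \sum_i (completes_at n i)%:R = 1 :> R.
Proof.
move=> /(@first_completion_attained (A n) (f n) _ (B n)) [[i0 Ii0 /eqP Di0] _].
have C0 : completes_first n i0 by rewrite /completes_first Ii0 Di0.
case: (@arg_minnP _ i0 (completes_first n) (fun i => i : nat)) => // i1 C1 min1.
rewrite (bigD1 i1) //= big1 ?addr0.
  rewrite /completes_at C1 /=; case: forallP => // -[] k.
  by apply/implyP => ki; apply/negP => /min1; rewrite leqNgt ki.
move=> i ii1; rewrite /completes_at; case: (boolP (completes_first n i)) => //= Ci.
case: forallP => // /(_ i1) /implyP H; exfalso.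
have := min1 _ Ci; rewrite leq_eqVlt => /orP[/eqP/ord_inj e|/H]; last by rewrite C1.
by rewrite e eqxx in ii1.
Qed.

Lemma completes_at_ex (n : nat) : I n != finset.set0 ->
  exists2 i, completes_first n i & forall k, completes_at n k = (k == i).
Proof.
move=> In0; have := completes_at_sum In0.
case: (pickP (completes_at n)) => [i Ci _|C0]; last first.
  by rewrite big1 => [/esym/eqP|i _]; rewrite ?oner_eq0 // C0.
exists i; first by case/andP: Ci.
move=> k; apply/idP/eqP => [Ck|->//].
move: Ci Ck; rewrite /completes_at => /andP[Ci /forallP Hi] /andP[Ck /forallP Hk].
case: (ltngtP k i) => [lt|lt|/ord_inj//].
  by have := implyP (Hi k) lt; rewrite Ck.
by have := implyP (Hk i) lt; rewrite Ci.
Qed.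

Lemma clear_time_le (n m : nat) (i : 'I_N) : (n <= m)%N -> f n i <= f m i.
Proof.
elim: m => [|m IH]; first by rewrite leqn0 => /eqP ->.
rewrite leq_eqVlt => /orP[/eqP ->//|/IH/le_trans]; apply => /=.
by case: ifP => // _; rewrite le_max lexx.
Qed.

Lemma departure_le_clear (n m : nat) (i : 'I_N) :
  i \in I n -> (n < m)%N -> D n <= f m i.
Proof.
move=> Ii /(clear_time_le i); apply: le_trans => /=.
by rewrite Ii le_max lexx orbT.
Qed.

Lemma finds_empty_clear (m : nat) (i : 'I_N) : 0 <= A m ->
  finds_empty A I B m -> f m i <= A m.
Proof.
move=> A0 Em; suff H n : (n <= m)%N -> f n i <= A m by exact: H.
elim: n => [//|n IH nm] /=; case: ifP => _; last exact: IH (ltnW nm).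
by rewrite ge_max IH ?(ltnW nm) //=; exact: Em.
Qed.

Lemma clear_finds_empty (m : nat) : (forall n, I n != finset.set0) ->
  (forall i, f m i <= A m) -> finds_empty A I B m.
Proof.
move=> In0 fA n nm; have /set0Pn[i Ii] := In0 n.
by rewrite (le_trans (departure_le_clear Ii nm)).
Qed.

(** Only successful replicas count; the time spent on replicas that are cancelled later is left
    out. *)
Definition useful (n : nat) (i : 'I_N) : R :=
  \sum_(k < n) (completes_at k i)%:R * B k i.

(** * Useful work against elapsed time *)

Section useful_work.
Hypothesis A_ge0 : 0 <= A 0%N.
Hypothesis A_ge : forall n, A 0%N <= A n.
Hypothesis I_gt1 : forall n, (1 < #|I n|)%N.

Let I_neq0 n : I n != finset.set0.
Proof. by rewrite -cards_eq0 -lt0n ltnW. Qed.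

(** The clock of server [i]: the time up to which the earlier jobs hold it, started at the first
    arrival because [clear_time] starts at 0. *)
Let g n i := Num.max (A 0%N) (f n i).

Let g_le n i : g n i <= g n.+1 i.
Proof. by rewrite /g ge_max !le_max lexx /= (clear_time_le i (leqnSn n)) orbT. Qed.

Let g_dep n i : i \in I n -> D n <= g n.+1 i.
Proof. by move=> Ii; rewrite /g le_max (departure_le_clear Ii (ltnSn n)) orbT. Qed.

Let usefulS n i : useful n.+1 i = useful n i + (completes_at n i)%:R * B n i.
Proof. by rewrite /useful big_ord_recr. Qed.

(** A successful replica has its server to itself for its whole processing time, so the credited
    services of one server occupy disjoint intervals. *)
Lemma useful_server n i : useful n i <= g n i - A 0%N.
Proof.
elim: n => [|n IH].
  by rewrite /useful big_ord0 /g subr_ge0 le_max lexx.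
have [s /andP[Is /eqP Ds] Cs] := completes_at_ex (I_neq0 n).
rewrite usefulS Cs; have [is_|_] := eqVneq i s; last first.
  by rewrite mul0r addr0 (le_trans IH) // lerD2r g_le.
rewrite mul1r is_ in IH *; have := g_dep Is; have := IH; rewrite Ds.
have : g n s <= Num.max (A n) (f n s).
  by rewrite /g ge_max !le_max A_ge lexx orbT.
lra.
Qed.

(* The oldest job present is in service at all its servers, so that at any time
   at least one server does work that will be thrown away: leaving out any one
   server, the others have had enough time for all the useful work. *)
Lemma useful_total n i0 :
  \sum_i useful n i <= \sum_(i | i != i0) (g n i - A 0%N).
Proof.
elim: n i0 => [|n IH] i0.
  rewrite big1; last by move=> i _; rewrite /useful big_ord0.
  by apply: sumr_ge0 => i _; rewrite /g subr_ge0 le_max lexx.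
have [s /andP[Is /eqP Ds] Cs] := completes_at_ex (I_neq0 n).
have -> : \sum_i useful n.+1 i = \sum_i useful n i + B n s.
  under eq_bigr do rewrite usefulS Cs.
  rewrite big_split /=; congr (_ + _).
  rewrite (bigD1 s) //= eqxx mul1r big1 ?addr0 // => i /negbTE ->.
  by rewrite mul0r.
have gs : g n s + B n s <= D n.
  by rewrite Ds lerD2r /g ge_max !le_max A_ge lexx orbT.
have [s0|s0] := eqVneq s i0; last first.
  rewrite [leRHS](bigD1 s) //=; have := IH i0; rewrite [leRHS](bigD1 s) //=.
  have : \sum_(i < N | (i != i0) && (i != s)) (g n i - A 0%N) <=
    \sum_(i < N | (i != i0) && (i != s)) (g n.+1 i - A 0%N).
    by apply: ler_sum => i _; rewrite lerD2r g_le.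
  have := g_dep Is; lra.
(* The completing server is the one left out. Another server [s'] of the job is held until the same
   departure, so its clock reaches at least [g n s + B n s]. Applying the induction hypothesis with
   [s'] left out instead pays for the new work; this is why [i0] is generalized. *)
have [s' Is' s's] : exists2 s', s' \in I n & s' != s.
  have : (0 < #|I n :\ s|)%N by have := I_gt1 n; rewrite (cardsD1 s) Is.
  by rewrite card_gt0 => /set0Pn[s']; rewrite !inE => /andP[? ?]; exists s'.
rewrite -s0 [leRHS](bigD1 s') //=; have := IH s'.
rewrite [leRHS](bigD1 s) 1?eq_sym //=.
have : \sum_(i < N | (i != s') && (i != s)) (g n i - A 0%N) <=
    \sum_(i < N | (i != s) && (i != s')) (g n.+1 i - A 0%N).
  rewrite (eq_bigl (fun i => (i != s) && (i != s'))).
    by apply: ler_sum => i _; rewrite lerD2r g_le.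
  by move=> i; rewrite andbC.
have := g_dep Is'; lra.
Qed.

Lemma useful_server_empty n i : finds_empty A I B n ->
  useful n i <= A n - A 0%N.
Proof.
move=> En; apply: (le_trans (useful_server n i)).
by rewrite lerD2r /g ge_max A_ge finds_empty_clear // (le_trans A_ge0).
Qed.

Lemma useful_total_empty n (i0 : 'I_N) : finds_empty A I B n ->
  \sum_i useful n i <= N.-1%:R * (A n - A 0%N).
Proof.
move=> En; apply: (le_trans (useful_total n i0)).
apply: (@le_trans _ _ (\sum_(i | i != i0) (A n - A 0%N))).
  apply: ler_sum => i _.
  by rewrite lerD2r /g ge_max A_ge finds_empty_clear // (le_trans A_ge0).
by rewrite sumr_const cardC1 card_ord mulr_natl.
Qed.
End useful_work.

(** * Workloads found by arrivals *)

Definition workload (n : nat) (i : 'I_N) : R := Num.max 0 (f n i - A n).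

(** Lindley's recursion. With a single replica nothing is cancelled: one server receives the
    processing time and all of them drain until the next arrival. *)
Lemma workloadS n (s i : 'I_N) : I n = finset.set1 s -> 0 <= B n s ->
  A n <= A n.+1 ->
  workload n.+1 i = Num.max 0 (workload n i + (i \in I n)%:R * B n i - (A n.+1 - A n)).
Proof.
move=> In Bs0 AA; rewrite /workload /= -/(D n).
have -> : D n = Num.max (A n) (f n s) + B n s.
  have In0 : I n != finset.set0 by rewrite In; apply/set0Pn; exists s; rewrite inE.
  have [[j Ij Dj] _] := @first_completion_attained (A n) (f n) _ (B n) In0.
  by rewrite /departure Dj; move: Ij; rewrite In inE => /eqP ->.
have maxE (x y : R) : x <= y -> Num.max x y = y by exact: max_r.
have maxE' (x y : R) : y <= x -> Num.max x y = x by exact: max_l.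
rewrite In inE; have [->|_] := eqVneq i s; rewrite ?mul1r ?mul0r ?addr0.
  case: (leP (A n) (f n s)) => h.
    rewrite (maxE 0 (f n s - A n)); last lra.
    rewrite (maxE (f n s)); last lra.
    by congr Num.max; ring.
  rewrite (maxE' 0 (f n s - A n)); last lra.
  rewrite (maxE (f n s)); last lra.
  by congr Num.max; ring.
case: (leP (A n) (f n i)) => h.
  by rewrite (maxE 0 (f n i - A n)); [congr Num.max; ring|lra].
rewrite (maxE' 0 (f n i - A n)); last lra.
rewrite !maxE' //; lra.
Qed.

Lemma workload0_finds_empty m : (forall n, I n != finset.set0) ->
  (forall i, workload m i = 0) -> finds_empty A I B m.
Proof.
move=> In0 W0; apply: clear_finds_empty => // i.
by have /eqP := W0 i; rewrite /workload eq_maxl subr_le0.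
Qed.

(** Job [n] belongs to the cycle opened by job 0. The index 0 is exempt, since job 0 itself finds
    the system empty. *)
Definition no_return (n : nat) : Prop :=
  forall k, (0 < k)%N -> (k <= n)%N -> ~ finds_empty A I B k.

Lemma no_returnS n : no_return n.+1 <-> no_return n /\ ~ finds_empty A I B n.+1.
Proof.
split=> [H|[H1 H2] k k0]; first by split=> [k k0 kn|]; apply: H => //; exact: leqW.
by rewrite leq_eqVlt => /orP[/eqP->//|]; rewrite ltnS; exact: H1.
Qed.

Lemma no_return_le n m : (m <= n)%N -> no_return n -> no_return m.
Proof. by move=> mn H k k0 km; apply: H => //; exact: leq_trans mn. Qed.

(** Arrival times being nondecreasing, the infimum is attained at the first return [m], and the jobs
    of the cycle are those before [m]. *)
Lemma cycle_length_return : {homo A : n m / (n <= m)%N >-> n <= m} ->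
  (exists n, ~ no_return n) -> exists m, [/\ (0 < m)%N, finds_empty A I B m,
    cycle_length A I B = (A m - A 0%N)%:E &
    forall n, no_return n <-> (n < m)%N].
Proof.
move=> ndA [n0 Hn0].
have ex : exists n, `[< (0 < n)%N /\ finds_empty A I B n >].
  apply: contrapT => H; apply: Hn0 => k k0 kn Ek; apply: H.
  by exists k; apply/asboolP.
case: (ex_minnP ex) => m /asboolP[m0 Em] minm; exists m; split => //.
  apply/eqP; rewrite eq_le; apply/andP; split.
    by apply: ereal_inf_lbound; exists m.
  apply: le_ereal_inf_tmp => _ [k [k0 Ek] <-].
  by rewrite lee_fin lerD2r ndA // minm //; apply/asboolP.
move=> n; split=> [nr|nm k k0 kn Ek].
  by rewrite ltnNge; apply/negP => mn; exact: (nr m).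
have /minm : `[< (0 < k)%N /\ finds_empty A I B k >] by apply/asboolP.
by rewrite leqNgt (leq_ltn_trans kn nm).
Qed.

Lemma cycle_length_no_return : (forall n, no_return n) ->
  cycle_length A I B = +oo%E.
Proof.
move=> nr; rewrite /cycle_length (_ : [set _ | _ in _] = set0) ?ereal_inf0 //.
by apply/seteqP; split => // x [k [k0 Ek] _]; exact: (nr k k k0 (leqnn k)).
Qed.

End sample_path.

(** * Measurability *)

Section finite_valued.
Context d (T : measurableType d) (K : finType).

(** Level sets suffice for a finite range, and [K] need not be given a sigma-algebra of its own. *)
Definition fin_measurable (g : T -> K) : Prop :=
  forall v, measurable_fun setT (fun t => g t == v).

Lemma measurable_fun_fin d' (T' : measurableType d') (g : T -> K)
    (h : K -> T -> T') : fin_measurable g ->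
  (forall v, measurable_fun setT (h v)) ->
  measurable_fun setT (fun t => h (g t) t).
Proof.
move=> mg mh _ B mB; rewrite setTI.
rewrite (_ : _ @^-1` B = \bigcup_(v in [set: K])
   ((fun t => g t == v) @^-1` [set true] `&` h v @^-1` B)).
  apply: fin_bigcup_measurable => [|v _]; first exact: finite_finset.
  apply: measurableI.
    by rewrite -[X in measurable X]setTI; exact: mg.
  by rewrite -[X in measurable X]setTI; exact: mh.
apply/seteqP; split=> [t /= Bt|t].
  by exists (g t) => //=; rewrite eqxx.
by case=> v _ /= [/eqP -> ].
Qed.

Lemma fin_measurable_mem (A : {set K}) (g : T -> K) : fin_measurable g ->
  measurable_fun setT (fun t => g t \in A).
Proof.
move=> mg; apply: (@measurable_fun_fin _ bool g (fun v _ => v \in A)) => // v.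
Qed.
End finite_valued.

Section measurable_path.
Context (R : realType) d (T : measurableType d) (N : nat).

Lemma measurable_bigmin (s : seq 'I_N) (x : T -> R) (F : 'I_N -> T -> R) :
  measurable_fun setT x -> (forall i, measurable_fun setT (F i)) ->
  measurable_fun setT (fun t => \big[Num.min/x t]_(i <- s) F i t).
Proof.
move=> mx mF; elim: s => [|i s IH]; first by under eq_fun do rewrite big_nil.
under eq_fun do rewrite big_cons.
exact: measurable_minr.
Qed.

Lemma measurable_first_completion (a : T -> R) (f b : 'I_N -> T -> R)
    (J : T -> {set 'I_N}) : measurable_fun setT a ->
  (forall i, measurable_fun setT (f i)) ->
  (forall i, measurable_fun setT (b i)) -> fin_measurable J ->
  measurable_fun setT
    (fun t => first_completion (a t) (f ^~ t) (J t) (b ^~ t)).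
Proof.
move=> ma mf mb mJ.
apply: (measurable_fun_fin
  (h := fun J t => first_completion (a t) (f ^~ t) J (b ^~ t)) mJ) => {mJ}J.
have [->|J0] := eqVneq J finset.set0.
  rewrite (_ : (fun _ => _) = cst (inf set0)); first exact: measurable_cst.
  apply/funext => t; rewrite /first_completion /=; congr inf.
  by apply/seteqP; split => // x [i]; rewrite /= inE.
have /set0Pn[i0 Ji0] := J0.
pose F i t := Num.max (a t) (f i t) + b i t.
rewrite (_ : (fun _ => _) =
  (fun t => \big[Num.min/F i0 t]_(i in J) F i t)).
  have mF i : measurable_fun setT (F i).
    by apply: measurable_funD => //; exact: measurable_maxr.
  under eq_fun do rewrite -big_enum.
  exact: measurable_bigmin.
apply/funext => t.
have [[i1 Ji1 e1] le1] :=
  @first_completion_attained R N (a t) (f ^~ t) J (b ^~ t) J0.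
apply/eqP; rewrite eq_le; apply/andP; split.
  by apply/bigmin_geP; split=> [|i Ji]; exact: le1.
by rewrite e1; apply: bigmin_le_cond.
Qed.

End measurable_path.

(** * The law of inverse transform sampling *)

Section sample_law.
Context (R : realType) (U : eqType) (x0 : U) (w : U -> R).

Lemma measurable_sample (s : seq U) (v : U) :
  measurable_fun [set: R] (fun u => sample x0 w s u == v).
Proof.
elim: s => [|x s IH] /=; first exact: measurable_cst.
under eq_fun do rewrite (fun_if (fun y => y == v)).
apply: measurable_fun_if => //.
- exact: measurable_fun_ltr.
- apply: (@measurable_funS _ _ _ _ setT) => //.
  apply: (measurableT_comp IH); exact: measurable_funB.
Qed.

Hypothesis w_ge0 : forall x, 0 <= w x.

(** Serves to exclude sets of the wrong cardinality, to which a static policy gives weight 0. *)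
Lemma sample_gt0 (s : seq U) (u : R) : 0 <= u -> u < \sum_(x <- s) w x ->
  0 < w (sample x0 w s u).
Proof.
elim: s u => [|x s IH] u u0; first by rewrite big_nil ltNge u0.
rewrite big_cons /= => us; case: (ltP u (w x)) => ux; first exact: le_lt_trans u0 ux.
by apply: IH; rewrite ?subr_ge0 // ltrBlDl.
Qed.

Lemma sample_mem (s : seq U) (u : R) : 0 <= u -> u < \sum_(x <- s) w x ->
  sample x0 w s u \in s.
Proof.
elim: s u => [|x s IH] u u0; first by rewrite big_nil ltNge u0.
rewrite big_cons /= => us; rewrite inE; case: (ltP u (w x)) => ux; first by rewrite eqxx.
by rewrite IH ?orbT // ?subr_ge0 // ltrBlDl.
Qed.

(** The left end [a] is the total weight of the values listed before [v]. Containment in the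
    interval is enough for an upper bound on the probability. *)
Lemma sample_itv (s : seq U) (v : U) : uniq s -> v \in s -> exists a,
  forall u, 0 <= u -> u < \sum_(x <- s) w x -> sample x0 w s u = v -> a <= u <= a + w v.
Proof.
elim: s => [//|x s IH] /= /andP[xs us]; rewrite inE => /orP[/eqP ->|vs].
  exists 0 => u u0; rewrite add0r u0 /= big_cons; case: (ltP u (w x)) => [/ltW//|ux usum].
  have su : u - w x < \sum_(x <- s) w x by rewrite ltrBlDl.
  have /sample_mem := su; rewrite subr_ge0 => /(_ ux) + e; by rewrite e (negbTE xs).
have [a Ha] := IH us vs; exists (a + w x) => u u0; rewrite big_cons.
case: (ltP u (w x)) => [_ _ e|ux usum e]; first by rewrite e vs in xs.
have := Ha (u - w x); rewrite subr_ge0 ltrBlDl => /(_ ux usum e); lra.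
Qed.

(** An inequality suffices, as it serves to bound the loads from above. *)
Lemma uniform_sample (s : seq U) (v : U) : uniq s -> v \in s ->
  \sum_(x <- s) w x = 1 ->
  (uniform_prob (@ltr01 R) [set u | sample x0 w s u == v] <= (w v)%:E)%E.
Proof.
move=> us vs w1; have [a Ha] := sample_itv us vs.
rewrite /uniform_prob integral_uniform_pdf.
have mS : measurable [set u | sample x0 w s u == v].
  by rewrite -[X in measurable X]setTI; apply: measurable_sample.
set S := _ `&` _.
have mS' : measurable S by exact: measurableI.
apply: (@le_trans _ _ (\int[lebesgue_measure]_(x in S) (cst 1 x))%E).
  apply: ge0_le_integral => //=.
  - by move=> x _; rewrite lee_fin uniform_pdf_ge0.
  - by apply/measurable_EFinP/measurable_funTS; exact: measurable_uniform_pdf.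
  - by move=> x _; rewrite lee_fin /uniform_pdf; case: ifP; rewrite ?subr0 ?invr1.
rewrite integral_cst // mul1e.
(* The mark 1 escapes [sample_itv] and may reach the default value; it is split off as a null
   set. *)
apply: (@le_trans _ _ (lebesgue_measure (`[a, a + w v]%classic `|` [set 1]))).
  apply: le_measure; rewrite ?inE //; first exact: measurableU.
  move=> u [/= /eqP su]; rewrite in_itv /= => /andP[u0 u1].
  move: u1; rewrite le_eqVlt => /orP[/eqP ->|u1]; first by right.
  by left; rewrite /= in_itv /=; apply: Ha; rewrite ?w1.
apply: (le_trans (measureU2 _ _ _)) => //.
rewrite [X in (_ + X <= _)%E](_ : _ = 0%E) ?adde0; last exact: lebesgue_measure_set1.
rewrite [X in (X <= _)%E](_ : _ = lebesgue_measure `[a, a + w v]%classic)//.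
rewrite lebesgue_measure_itv /= lte_fin; case: ifPn => _.
  by rewrite -EFinB lee_fin; lra.
by rewrite lee_fin.
Qed.

End sample_law.

(** * The primitive sources in chronological order *)

Section primitive_sources.
Context (R : realType) (dT : measure_display) (T : measurableType dT).
Variables (P : probability T R) (N M : nat).
Variables (p : 'I_M -> R) (lawX lawS : 'I_M -> probability R R).
Variable X : primitives P N M.
Hypothesis X_law : primitives_law X p lawX lawS.

(* The sources of all jobs in chronological order, so that what is known when
   job [n] arrives is the past of index [n * 5 + 1]. *)
Definition source_code (c : nat) : nat * source :=
  ((c %/ 5)%N, nth DispatchMark [:: Interarrival; JobType; JobSize; Variation]
     (c %% 5)%N).

Lemma source_code_inj : injective source_code.
Proof.
move=> c c' [ecc'] en; rewrite (divn_eq c 5) (divn_eq c' 5) ecc'; congr (_ + _)%N.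
move: en (ltn_pmod c (isT : 0 < 5)%N) (ltn_pmod c' (isT : 0 < 5)%N).
by case: (c %% 5)%N => [|[|[|[|[|?]]]]] //; case: (c' %% 5)%N => [|[|[|[|[|?]]]]].
Qed.

Definition info (c : nat) : set (set T) := source_events X (source_code c).

Lemma source_codeE n k : (k < 5)%N -> source_code (n * 5 + k) =
  (n, nth DispatchMark [:: Interarrival; JobType; JobSize; Variation] k).
Proof. by move=> k5; rewrite /source_code divnMDl // modnMDl modn_small // divn_small // addn0. Qed.

Lemma generated_by_measurable (K : Type) (f : K -> {RV P >-> R}) :
  generated_by f `<=` @measurable _ T.
Proof.
apply: smallest_sub; first exact: sigma_algebra_measurable.
move=> A [k [B [mB ->]]]; rewrite -[X in measurable X]setTI.
exact: measurable_funP.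
Qed.

Lemma generated_by_setI (K : Type) (f : K -> T -> R) :
  setI_closed (generated_by f).
Proof.
move=> A B sA sB.
exact: (@measurableI _ (g_sigma_algebraType
  [set A | exists k (B : set R), measurable B /\ A = f k @^-1` B]) A B).
Qed.

Lemma generated_by_setT (K : Type) (f : K -> T -> R) : generated_by f setT.
Proof.
exact: (@measurableT _ (g_sigma_algebraType
  [set A | exists k (B : set R), measurable B /\ A = f k @^-1` B])).
Qed.

Lemma job_type_event n (B : set 'I_M) : measurable (job_type X n @^-1` B).
Proof.
rewrite (_ : _ @^-1` B = \bigcup_(j in B) (job_type X n @^-1` [set j])).
  apply: fin_bigcup_measurable => [|j _]; first exact: finite_finset.
  exact: (job_type_measurable X_law).
by apply/seteqP; split=> [t Bt|t [j Bj /= ->]//]; exists (job_type X n t).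
Qed.

Lemma info_measurable c : info c `<=` @measurable _ T.
Proof.
rewrite /info; case: (source_code c) => n [] /=; rewrite /source_events /=;
  try exact: generated_by_measurable.
by move=> A [B ->]; exact: job_type_event.
Qed.

Lemma info_setI c : setI_closed (info c).
Proof.
rewrite /info; case: (source_code c) => n [] /=; rewrite /source_events /=;
  try exact: generated_by_setI.
by move=> A B [C ->] [D ->]; exists (C `&` D).
Qed.

Lemma info_setT c : info c setT.
Proof.
rewrite /info; case: (source_code c) => n [] /=; rewrite /source_events /=;
  try exact: generated_by_setT.
by exists setT.
Qed.

Lemma info_independent : mutually_independent P info.
Proof.
move=> m k A k_inj FA; apply: (primitives_independent X_law) FA.
exact: inj_comp source_code_inj k_inj.
Qed.

Lemma generated_by_preimage (K : Type) (f : K -> T -> R) k (B : set R) :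
  measurable B -> generated_by f (f k @^-1` B).
Proof. by move=> mB; apply: sub_sigma_algebra; exists k, B. Qed.

Lemma info_interarrival n (B : set R) : measurable B ->
  info (n * 5) (unit_interarrival X n @^-1` B).
Proof.
move=> mB; rewrite /info -[(n * 5)%N]addn0 source_codeE //.
exact: (@generated_by_preimage _ (fun _ : unit => unit_interarrival X n) tt).
Qed.

Lemma info_type n (B : set 'I_M) : info (n * 5 + 1) (job_type X n @^-1` B).
Proof. by rewrite /info source_codeE //=; exists B. Qed.

Lemma info_sizes n A : generated_by (job_size X n) A -> info (n * 5 + 2) A.
Proof. by rewrite /info source_codeE. Qed.

Lemma info_size n j (B : set R) : measurable B ->
  info (n * 5 + 2) (job_size X n j @^-1` B).
Proof. by move=> mB; apply: info_sizes; exact: generated_by_preimage. Qed.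

Lemma info_variation n i j (B : set R) : measurable B ->
  info (n * 5 + 3) (Defs.variation X n i j @^-1` B).
Proof.
move=> mB; rewrite /info source_codeE //.
exact: (@generated_by_preimage _ (fun ij : 'I_N * 'I_M => Defs.variation X n ij.1 ij.2) (i, j)).
Qed.

Lemma info_mark n (B : set R) : measurable B ->
  info (n * 5 + 4) (dispatch_mark X n @^-1` B).
Proof.
move=> mB; rewrite /info source_codeE //.
exact: (@generated_by_preimage _ (fun _ : unit => dispatch_mark X n) tt).
Qed.

(** * What is known at each arrival *)

Section adapted_state.
Variables (r : 'I_N -> 'I_M -> R) (q : 'I_M -> {set 'I_N} -> R) (lam : R).

Local Notation A t := (arrival_time X lam t).
Local Notation I t := (assigned_set X q t).
Local Notation B t := (processing_time X r t).
Local Notation adp := (adapted info).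

Lemma adapted_info c c' (Y : T -> R) :
  (forall B, measurable B -> info c (Y @^-1` B)) -> (c < c')%N -> adp c' Y.
Proof.
by move=> HY cc'; apply: (adapted_mono (c := c.+1)) => //; exact: adapted_gen.
Qed.

Lemma adapted_type n c : (n * 5 + 1 < c)%N ->
  fin_measurable (job_type X n : pastT info c -> 'I_M).
Proof.
move=> nc j.
apply: (adapted_mono (c := (n * 5 + 1).+1) (f := fun t => job_type X n t == j)) => //.
apply: adapted_gen => C _.
exact: (info_type n [set j' | C (j' == j)]).
Qed.

Lemma adapted_arrival n : adp (n * 5).+1 (fun t => A t n).
Proof.
rewrite /arrival_time.
apply: (@measurable_sum _ (pastT info (n * 5).+1)) => k.
apply: (@measurable_funM _ (pastT info (n * 5).+1) R); last exact: measurable_cst.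
apply: adapted_info (@info_interarrival k) _.
by rewrite ltnS leq_mul2r -ltnS ltn_ord orbT.
Qed.

Lemma adapted_assigned n : fin_measurable (fun t : pastT info (n.+1 * 5) => I t n).
Proof.
move=> J; rewrite /assigned_set.
apply: (@measurable_fun_fin _ (pastT info (n.+1 * 5)) _ _ bool (job_type X n)
  (fun j t => sample (finset.set0 : {set _}) (q j) (enum {: {set 'I_N}}) (dispatch_mark X n t) == J)).
  by apply: adapted_type; rewrite mulSn addnC ltn_add2r.
move=> j; apply: (measurableT_comp (measurable_sample _ _ _ _)).
by apply: adapted_info (@info_mark n) _; rewrite mulSn addnC ltn_add2r.
Qed.

Lemma adapted_processing n i : adp (n.+1 * 5) (fun t => B t n i).
Proof.
rewrite /processing_time.
apply: (@measurable_fun_fin _ (pastT info (n.+1 * 5)) _ _ _ (job_type X n)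
  (fun j t => job_size X n j t * Defs.variation X n i j t / r i j)).
  by apply: adapted_type; rewrite mulSn addnC ltn_add2r.
move=> j; apply: (@measurable_funM _ (pastT info _) R); last exact: measurable_cst.
apply: (@measurable_funM _ (pastT info _) R).
  by apply: adapted_info (@info_size n j) _; rewrite mulSn addnC ltn_add2r.
by apply: adapted_info (@info_variation n i j) _; rewrite mulSn addnC ltn_add2r.
Qed.

Lemma adapted_departure_clear n :
  (forall i, adp (n * 5) (fun t => clear_time (A t) (I t) (B t) n i)) ->
  adp (n.+1 * 5) (fun t => departure (A t) (I t) (B t) n).
Proof.
move=> IH; rewrite /departure.
apply: (@measurable_first_completion _ _ (pastT info (n.+1 * 5)) N
  (fun t => A t n) (fun i t => clear_time (A t) (I t) (B t) n i)
  (fun i t => B t n i) (fun t => I t n)).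
- by refine (adapted_mono _ (@adapted_arrival n)); rewrite mulSn addnC -addn1 leq_add2l.
- by move=> i; refine (adapted_mono _ (IH i)); rewrite leq_mul2r leqnSn orbT.
- by move=> i; exact: adapted_processing.
- exact: adapted_assigned.
Qed.

Lemma adapted_clear n i : adp (n * 5) (fun t => clear_time (A t) (I t) (B t) n i).
Proof.
elim: n i => [|n IH] i; first exact: measurable_cst.
have IH' : adp (n.+1 * 5) (fun t => clear_time (A t) (I t) (B t) n i).
  by refine (adapted_mono _ (IH i)); rewrite leq_mul2r leqnSn orbT.
have mI : adp (n.+1 * 5) (fun t => i \in I t n).
  rewrite /adapted.
  rewrite (_ : (fun t => i \in I t n) = (fun t => I t n \in [set J : {set 'I_N} | i \in J]%SET)).
    exact: (fin_measurable_mem _ (@adapted_assigned n)).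
  by apply/funext => t; rewrite inE.
apply: (@measurable_fun_if _ _ (pastT info (n.+1 * 5)) R) => //.
- apply: (@measurable_funS _ _ _ _ setT) => //.
  apply: (@measurable_maxr _ (pastT info (n.+1 * 5)) R) => //.
  exact: adapted_departure_clear.
- exact: (@measurable_funS _ _ _ _ setT).
Qed.

Lemma adapted_departure n : adp (n.+1 * 5) (fun t => departure (A t) (I t) (B t) n).
Proof. by apply: adapted_departure_clear => i; exact: adapted_clear. Qed.

Lemma adapted_le c (f g : T -> R) : adp c f -> adp c g ->
  (measurable : set (set (pastT info c))) [set t | f t <= g t].
Proof.
move=> af ag; rewrite -[X in measurable X]setTI.
by apply: (@measurable_fun_ler _ (pastT info c) R setT f g _ _ _ [set true]).
Qed.

Lemma finds_empty_event n : (measurable : set (set (pastT info (n * 5).+1)))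
  [set t | finds_empty (A t) (I t) (B t) n].
Proof.
rewrite (_ : [set t | _] = \bigcap_(m < n) [set t | departure (A t) (I t) (B t) m <= A t n]) //.
apply: fin_bigcap_measurable => [|m mn]; first exact: finite_II.
apply: adapted_le; last exact: adapted_arrival.
by refine (adapted_mono _ (@adapted_departure m)); rewrite leqW // leq_mul2r mn orbT.
Qed.

Definition in_cycle (n : nat) : set T := [set t | no_return (A t) (I t) (B t) n].

(** Settled by the departures of the earlier jobs and the arrival time of job [n]; hence independent
    of everything that job [n] draws and of the next gap. *)
Lemma in_cycle_event n : (measurable : set (set (pastT info (n * 5).+1))) (in_cycle n).
Proof.
elim: n => [|n IH].
  rewrite (_ : in_cycle 0 = setT); first exact: measurableT.
  by apply/seteqP; split => // t _ [].
rewrite (_ : in_cycle n.+1 = in_cycle n `&` ~` [set t | finds_empty (A t) (I t) (B t) n.+1]).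
  apply: measurableI; last by apply: measurableC; exact: finds_empty_event.
  by apply: past_gen_mono _ IH; rewrite ltnS leq_mul2r leqnSn orbT.
by apply/seteqP; split => t /no_returnS.
Qed.

Lemma completes_at_event n i : (measurable : set (set (pastT info (n.+1 * 5))))
  [set t | completes_at (A t) (I t) (B t) n i].
Proof.
pose c := (n.+1 * 5)%N.
have mI k : measurable_fun [set: pastT info c] (fun t => k \in I t n).
  rewrite (_ : (fun t => k \in I t n) = (fun t => I t n \in [set J : {set 'I_N} | k \in J]%SET)).
    exact: (fin_measurable_mem _ (@adapted_assigned n)).
  by apply/funext => t; rewrite inE.
have mC k : measurable_fun [set: pastT info c]
    (fun t => completes_first (A t) (I t) (B t) n k).
  apply: measurable_and => //; apply: measurable_fun_eqr.
    exact: adapted_departure.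
  apply: measurable_funD; last exact: adapted_processing.
  apply: measurable_maxr.
    by refine (adapted_mono _ (@adapted_arrival n)); rewrite /c mulSn addnC -addn1 leq_add2l.
  by refine (adapted_mono _ (@adapted_clear n k)); rewrite /c leq_mul2r leqnSn orbT.
rewrite (_ : [set t | _] = (fun t => completes_first (A t) (I t) (B t) n i) @^-1` [set true] `&`
  \bigcap_(k in [set k : 'I_N | (k < i)%N])
   (fun t => completes_first (A t) (I t) (B t) n k) @^-1` [set false]).
  apply: measurableI; first by rewrite -[X in measurable X]setTI; exact: mC.
  apply: fin_bigcap_measurable => [|k _]; first exact: finite_finset.
  by rewrite -[X in measurable X]setTI; exact: mC.
apply/seteqP; split => t /=.
  by move=> /andP[-> /forallP H]; split => // k ki; apply/negbTE; exact: implyP (H k) ki.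
case=> Ci Ck; rewrite /completes_at Ci /=; apply/forallP => k; apply/implyP => ki.
by rewrite (Ck k ki).
Qed.

Lemma in_cycle_measurable n : measurable (in_cycle n).
Proof. exact: (past_gen_measurable info_measurable (@in_cycle_event n)). Qed.

(** The infimum over a random set of indices becomes one over all [n], with value +oo at the indices
    that do not qualify. *)
Lemma measurable_cycle_length :
  measurable_fun setT (fun t => cycle_length (A t) (I t) (B t)).
Proof.
have mA n : measurable_fun setT (fun t => A t n).
  exact: (adapted_measurable info_measurable (@adapted_arrival n)).
pose G n t : \bar R := if (0 < n)%N && `[< finds_empty (A t) (I t) (B t) n >]
   then (A t n - A t 0%N)%:E else +oo%E.
have mG n : measurable_fun setT (G n).
  apply: measurable_fun_if => //.
  - apply: measurable_and; first exact: measurable_cst.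
    apply: (measurable_fun_bool true) => //.
    rewrite setTI (_ : _ @^-1` _ = [set t | finds_empty (A t) (I t) (B t) n]).
      exact: (past_gen_measurable info_measurable (@finds_empty_event n)).
    by apply/seteqP; split => t /=; [move/asboolP|move=> ?; apply/asboolP].
  - apply: (@measurable_funS _ _ _ _ setT) => //.
    by apply/measurable_EFinP; exact: measurable_funB.
rewrite (_ : (fun t => _) = (fun t => einfs (G ^~ t) 0%N)).
  exact: measurable_fun_einfs.
apply/funext => t; rewrite /einfs /sdrop /cycle_length.
apply/eqP; rewrite eq_le; apply/andP; split.
  apply: le_ereal_inf_tmp => _ [n _ <-]; rewrite /G.
  case: ifPn => [/andP[n0 /asboolP En]|_]; last exact: leey.
  by apply: ereal_inf_lbound; exists n.
apply: le_ereal_inf_tmp => _ [n [n0 En] <-].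
apply: ereal_inf_lbound; exists n => //.
by rewrite /G n0 /=; case: asboolP.
Qed.

End adapted_state.
End primitive_sources.

(** * The laws of the sources *)

Section random_variable_facts.
Context (R : realType) (dT : measure_display) (T : measurableType dT).
Variable P : probability T R.

Lemma ae_distribution1 (Y : {RV P >-> R}) (B : set R) : measurable B ->
  distribution P Y B = 1%E -> {ae P, forall t, B (Y t)}.
Proof.
move=> mB PB.
have mYB : measurable (Y @^-1` B).
  by rewrite -[X in measurable X]setTI; exact: measurable_funP.
exists (~` (Y @^-1` B)); split; [exact: measurableC| |by []].
have PYB : P (Y @^-1` B) = 1%E by [].
by rewrite probability_setC // PYB subee.
Qed.

Lemma ge0_integral_law (Y : {RV P >-> R}) (mu : probability R R) (f : R -> \bar R) :
  (forall B, measurable B -> distribution P Y B = mu B) ->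
  measurable_fun [set: R] f -> (forall x, 0 <= f x)%E ->
  (\int[P]_t f (Y t) = \int[mu]_x f x)%E.
Proof.
move=> law mf f0; rewrite -(ge0_integral_distribution Y) //.
by apply: eq_measure_integral => B mB _; exact: law.
Qed.

Lemma measurable_pos : measurable_fun [set: R] (fun x : R => Num.max 0 x).
Proof. by apply: measurable_maxr => //; exact: measurable_cst. Qed.
End random_variable_facts.

Section positive_mean.
Context (R : realType) (mu : probability R R).
Hypothesis mu_mean : positive_mean_law mu.

Lemma positive_mean_ae : {ae mu, forall x : R, 0 <= x}.
Proof.
have [mu1 _] := mu_mean; exists (~` `[0, +oo[%classic); split.
- by apply: measurableC.
- by rewrite probability_setC // mu1 subee.
- by move=> x /= nx; rewrite in_itv /= andbT.
Qed.

Lemma positive_meanE :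
  (\int[mu]_x (Num.max 0 x)%:E = \int[mu]_x x%:E)%E.
Proof.
apply: ae_eq_integral => //.
- by apply/measurable_EFinP; exact: measurable_pos.
by apply: filterS positive_mean_ae => x x0 _; rewrite max_r.
Qed.

Lemma positive_mean_fin : (0 < \int[mu]_x (Num.max 0 x)%:E < +oo)%E.
Proof. by rewrite positive_meanE; case: mu_mean. Qed.

End positive_mean.

Section exponential_law.
Context (R : realType) (dT : measure_display) (T : measurableType dT).
Variables (P : probability T R) (Y : {RV P >-> R}).
Hypothesis Y_law : forall B : set R, measurable B ->
  distribution P Y B = exponential_prob 1 B.

Lemma exponential_lt0 : distribution P Y `]-oo, 0[ = 0%E.
Proof.
rewrite Y_law // /exponential_prob integral0_eq // => x /=.
by rewrite in_itv /= => x0; rewrite lt0_exponential_pdf.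
Qed.

Lemma exponential_ae_ge0 : {ae P, forall t, 0 <= Y t}.
Proof.
have : {ae P, forall t, `[0, +oo[%classic (Y t)}.
  apply: ae_distribution1 => //.
  rewrite -[`[0, +oo[%classic]setCK setCitvr.
  have e := probability_setC (distribution P Y) (measurable_itv `]-oo, 0[).
  by rewrite e [X in (1 - X)%E]exponential_lt0 sube0.
by apply: filterS => t /=; rewrite in_itv /= andbT.
Qed.

Lemma exponential_tail (x : R) : 0 < x ->
  P [set t | x < Y t] = (expR (- x))%:E.
Proof.
move=> x0; rewrite (_ : P _ = ccdf Y x); last first.
  rewrite /ccdf /distribution /pushforward; congr (P _).
  by apply/seteqP; split=> t /=; rewrite in_itv /= andbT.
rewrite ccdf_1_cdf /cdf.
rewrite (_ : `]-oo, x]%classic = `]-oo, 0[%classic `|` `[0, x]%classic); last first.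
  apply/seteqP; split=> y /=; rewrite !in_itv /=.
    by move=> yx; have [y0|y0] := ltP y 0; [left|right].
  by case=> [/ltW/le_trans-> //|/andP[_ ->//]]; exact: ltW.
rewrite measureU //; last first.
  by apply/seteqP; split=> // y /= []; rewrite !in_itv /= => y0 /andP[]; rewrite leNgt y0.
rewrite [X in (1 - (X + _))%E]exponential_lt0 add0e.
rewrite [X in (1 - X)%E]Y_law // exponential_prob_itv0c //.
by rewrite -!EFinB mulN1r; congr _%:E; ring.
Qed.

(** The tail of the standard exponential law equals its density, so the tail integral for the mean
    is at most the total mass. Positivity follows from the mass beyond 1. *)
Lemma exponential_mean :
  (0 < \int[P]_t (Num.max 0 (Y t))%:E < +oo)%E.
Proof.
have mY : measurable_fun setT (fun t => Num.max 0 (Y t)).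
  by apply: (measurableT_comp (@measurable_pos R)).
pose Ym : {mfun T >-> R} := HB.pack (fun t => Num.max 0 (Y t)) (isMeasurableFun.Build _ _ _ _ _ mY).
have m1 : measurable [set t | 1 < Y t].
  by rewrite -[X in measurable X]setTI; exact: measurable_fun_ltr.
apply/andP; split.
  apply: (@lt_le_trans _ _ (\int[P]_t (\1_[set t | (1 < Y t)%R] t)%:E)%E).
    by rewrite integral_indic // setIT [ltRHS](exponential_tail ltr01) lte_fin expR_gt0.
  apply: ge0_le_integral => //.
  - by apply/measurable_EFinP; exact: measurable_indic.
  - by apply/measurable_EFinP.
  move=> t _; rewrite lee_fin indicE.
  case: (boolP (t \in _)) => [|_]; last by rewrite le_max lexx.
  by rewrite inE /= => /ltW Yt; rewrite le_max Yt orbT.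
have Ym0 t : 0 <= Ym t by rewrite /= le_max lexx.
suff: ('E_P[Ym] < +oo)%E by rewrite expectation_def.
rewrite ge0_expectation_ccdf //.
apply: (@le_lt_trans _ _ (exponential_prob 1 `[0, +oo[%classic)).
  rewrite /exponential_prob.
  apply: ae_ge0_le_integral => //.
  - exact: measurable_funTS (ccdf_measurable Ym).
  - by move=> x _; rewrite lee_fin exponential_pdf_ge0.
  - by apply/measurable_funTS/measurable_EFinP; exact: measurable_exponential_pdf.
  exists [set 0]; split; [by []|exact: lebesgue_measure_set1|].
  move=> x /= Hx; apply: contrapT => x0; apply: Hx; rewrite in_itv /= andbT => x_ge0.
  have {}x0 : 0 < x by rewrite lt_neqAle x_ge0 andbT eq_sym; exact/eqP.
  rewrite exponential_pdfE // mul1r mulN1r -exponential_tail //.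
  rewrite -[leLHS]/(P (Ym @^-1` `]x, +oo[%classic)).
  apply: le_measure; rewrite ?inE.
  - by rewrite -[X in measurable X]setTI; exact: (measurable_funP Ym).
  - by rewrite -[X in measurable X]setTI; exact: measurable_fun_ltr.
  by move=> t /=; rewrite in_itv /= andbT lt_max => /orP[|//]; rewrite ltNge x_ge0.
apply: (@le_lt_trans _ _ (exponential_prob 1 [set: R])).
  apply: ge0_subset_integral => //.
    by apply/measurable_EFinP; exact: measurable_exponential_pdf.
  by move=> x _; rewrite lee_fin exponential_pdf_ge0.
by rewrite /exponential_prob integral_exponential_pdf ?ltry.
Qed.

End exponential_law.

(** * Factoring out the sources of one job *)

Section model.
Context (R : realType) (dT : measure_display) (T : measurableType dT).
Variables (P : probability T R) (N M : nat).
Variables (p : 'I_M -> R) (lawX lawS : 'I_M -> probability R R).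
Variables (c : 'I_M -> R) (X : primitives P N M).
Hypothesis lawX_mean : forall j, positive_mean_law (lawX j).
Hypothesis X_law : primitives_law X p lawX lawS.
Hypothesis lawS_const : forall j, lawS j [set c j] = 1%E.

Local Notation adp := (adapted (info X)).

(** Sizes and gaps are nonnegative only almost surely. Their positive parts are so everywhere, which
    lets nonnegative integration run without exceptional sets. *)
Definition size_pos n j t : R := Num.max 0 (job_size X n j t).
Definition interarrival_pos n t : R := Num.max 0 (unit_interarrival X n t).

Definition mean_size j : R := fine (\int[lawX j]_x (Num.max 0 x)%:E).
Definition mean_interarrival : R :=
  fine (\int[P]_t (interarrival_pos 0 t)%:E).

Lemma measurable_size_pos n j : measurable_fun setT (size_pos n j).
Proof. exact: (measurableT_comp (@measurable_pos R)). Qed.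

Lemma measurable_interarrival_pos n : measurable_fun setT (interarrival_pos n).
Proof. exact: (measurableT_comp (@measurable_pos R)). Qed.

Lemma size_pos_ge0 n j t : 0 <= size_pos n j t.
Proof. by rewrite le_max lexx. Qed.

Lemma interarrival_pos_ge0 n t : 0 <= interarrival_pos n t.
Proof. by rewrite le_max lexx. Qed.

Lemma mean_sizeE j : (\int[lawX j]_x (Num.max 0 x)%:E = (mean_size j)%:E)%E.
Proof.
have /andP[m0 moo] := positive_mean_fin (lawX_mean j).
by rewrite fineK // ge0_fin_numE // ltW.
Qed.

Lemma mean_size_gt0 j : 0 < mean_size j.
Proof.
by have /andP[+ _] := positive_mean_fin (lawX_mean j); rewrite mean_sizeE lte_fin.
Qed.

Lemma integral_size_pos n j (g : R -> R) : measurable_fun [set: R] g ->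
  (forall x, 0 <= g x) ->
  (\int[P]_t (g (size_pos n j t))%:E = \int[lawX j]_x (g (Num.max 0 x))%:E)%E.
Proof.
move=> mg g0.
apply: (ge0_integral_law (f := fun x => (g (Num.max 0 x))%:E)
  (job_size_law X_law n j)) => // [|x]; last by rewrite lee_fin.
by apply/measurable_EFinP; exact: (measurableT_comp mg (@measurable_pos R)).
Qed.

Lemma size_pos_mean n j : (\int[P]_t (size_pos n j t)%:E = (mean_size j)%:E)%E.
Proof.
rewrite -mean_sizeE.
apply: (ge0_integral_law (f := fun x => (Num.max 0 x)%:E)
  (job_size_law X_law n j)) => //.
- by apply/measurable_EFinP; exact: measurable_pos.
- by move=> x; rewrite lee_fin le_max lexx.
Qed.

Lemma integral_interarrival_pos n (g : R -> R) : measurable_fun [set: R] g ->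
  (forall x, 0 <= g x) ->
  (\int[P]_t (g (interarrival_pos n t))%:E =
   \int[P]_t (g (interarrival_pos 0 t))%:E)%E.
Proof.
move=> mg g0.
have mf : measurable_fun [set: R] (fun x => (g (Num.max 0 x))%:E).
  by apply/measurable_EFinP; exact: (measurableT_comp mg (@measurable_pos R)).
have law B : measurable B -> distribution P (unit_interarrival X n) B =
    distribution P (unit_interarrival X 0) B.
  by move=> mB; rewrite !(unit_interarrival_law X_law).
have f0 (x : R) : (0 <= (g (Num.max 0 x))%:E)%E by rewrite lee_fin.
rewrite (ge0_integral_law (f := fun x => (g (Num.max 0 x))%:E) law mf) //.
by rewrite ge0_integral_distribution.
Qed.

Lemma mean_interarrival_gt0 : 0 < mean_interarrival.
Proof.
have /andP[m0 moo] := exponential_mean (unit_interarrival_law X_law 0).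
by rewrite -lte_fin fineK // ge0_fin_numE // ltW.
Qed.

Lemma interarrival_pos_mean n :
  (\int[P]_t (interarrival_pos n t)%:E = mean_interarrival%:E)%E.
Proof.
have /andP[m0 moo] := exponential_mean (unit_interarrival_law X_law 0).
rewrite /mean_interarrival fineK; last by rewrite ge0_fin_numE // ltW.
have mf : measurable_fun [set: R] (fun x : R => (Num.max 0 x)%:E).
  by apply/measurable_EFinP; exact: measurable_pos.
have f0 (x : R) : (0 <= (Num.max 0 x)%:E)%E by rewrite lee_fin le_max lexx.
have law B : measurable B -> distribution P (unit_interarrival X n) B =
    distribution P (unit_interarrival X 0) B.
  by move=> mB; rewrite !(unit_interarrival_law X_law).
rewrite (ge0_integral_law (f := fun x => (Num.max 0 x)%:E) law mf) //.
by rewrite ge0_integral_distribution.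
Qed.

Lemma past_prod k (Z Y : T -> R) : adp k Z ->
  (forall B, measurable B -> info X k (Y @^-1` B)) ->
  (forall t, 0 <= Z t) -> (forall t, 0 <= Y t) ->
  (\int[P]_t (Z t * Y t)%:E = \int[P]_t (Z t)%:E * \int[P]_t (Y t)%:E)%E.
Proof.
apply: expectation_prod.
- exact: (info_measurable X_law).
- exact: info_setI.
- exact: info_setT.
- exact: (info_independent X_law).
Qed.

Lemma past_interarrival n (Z : T -> R) (g : R -> R) :
  adp (n * 5).+1 Z -> (forall t, 0 <= Z t) ->
  measurable_fun [set: R] g -> (forall x, 0 <= g x) ->
  (\int[P]_t (Z t * g (interarrival_pos n.+1 t))%:E =
   \int[P]_t (Z t)%:E * \int[P]_t (g (interarrival_pos 0 t))%:E)%E.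
Proof.
move=> aZ Z0 mg g0; rewrite -(integral_interarrival_pos n.+1) //.
apply: (past_prod (k := (n.+1 * 5)%N)) => //.
  by refine (adapted_mono _ aZ); rewrite mulSn addnC -addn1 leq_add2l.
move=> B mB.
have := @info_interarrival _ _ _ _ _ _ X n.+1
  ((fun x => g (Num.max 0 x)) @^-1` B); apply.
rewrite -[X in measurable X]setTI.
exact: (measurableT_comp mg (@measurable_pos R)).
Qed.

Lemma measurable_natr_bool : measurable_fun [set: bool] (fun b : bool => b%:R : R).
Proof. by []. Qed.

Lemma adapted_type_indic n j :
  adp (n * 5 + 2) (fun t => (job_type X n t == j)%:R : R).
Proof.
have := @adapted_type _ _ _ P N M X n (n * 5 + 2)%N.
rewrite ltn_add2l => /(_ isT j) mt.
exact: (measurableT_comp measurable_natr_bool mt).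
Qed.

Lemma past_type n (Z : T -> R) j :
  adp (n * 5).+1 Z -> (forall t, 0 <= Z t) ->
  (\int[P]_t (Z t * (job_type X n t == j)%:R)%:E =
   \int[P]_t (Z t)%:E * (p j)%:E)%E.
Proof.
move=> aZ Z0; rewrite (past_prod (k := (n * 5 + 1)%N)) //.
- congr (_ * _)%E; rewrite -(job_type_law X_law n j).
  rewrite -[X in P X]setIT -integral_indic //; last exact: (job_type_measurable X_law).
  apply: eq_integral => t _; rewrite indicE.
  by rewrite (_ : (t \in _) = (job_type X n t == j)) //; apply/idP/eqP; rewrite inE.
- by rewrite addn1.
- move=> B mB.
  by have := info_type X n [set j' | B (j' == j)%:R].
Qed.

Lemma past_type_size n (Z : T -> R) j (g : R -> R) :
  adp (n * 5).+1 Z -> (forall t, 0 <= Z t) ->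
  measurable_fun [set: R] g -> (forall x, 0 <= g x) ->
  (\int[P]_t (Z t * (job_type X n t == j)%:R * g (size_pos n j t))%:E =
   \int[P]_t (Z t)%:E * (p j)%:E * \int[lawX j]_x (g (Num.max 0 x))%:E)%E.
Proof.
move=> aZ Z0 mg g0; rewrite -(past_type j aZ Z0) -(integral_size_pos n) //.
apply: (past_prod (k := (n * 5 + 2)%N)) => //.
- apply: (@measurable_funM _ (pastT (info X) _) R); last exact: adapted_type_indic.
  by refine (adapted_mono _ aZ); rewrite addn2.
- move=> B mB; have := @info_size _ _ _ _ _ _ X n j
    ((fun x => g (Num.max 0 x)) @^-1` B); apply.
  rewrite -[X in measurable X]setTI.
  exact: (measurableT_comp mg (@measurable_pos R)).
- by move=> t; rewrite mulr_ge0.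
Qed.

(** The sources of a job are split off latest first: the mark, then the size, then the type, down to
    the past in [Z]. *)
Lemma past_type_size_mark n (Z : T -> R) j (S : set R) :
  adp (n * 5).+1 Z -> (forall t, 0 <= Z t) -> measurable S ->
  (\int[P]_t (Z t * (job_type X n t == j)%:R * size_pos n j t *
                \1_S (dispatch_mark X n t))%:E =
   \int[P]_t (Z t)%:E * (p j)%:E * (mean_size j)%:E *
     uniform_prob (@ltr01 R) S)%E.
Proof.
move=> aZ Z0 mS.
have mpos := @measurable_pos R.
have aW : adp (n * 5 + 4) (fun t => Z t * (job_type X n t == j)%:R * size_pos n j t).
  apply: (@measurable_funM _ (pastT (info X) _) R).
    apply: (@measurable_funM _ (pastT (info X) _) R).
      by refine (adapted_mono _ aZ); rewrite -addn1 leq_add2l.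
    by refine (adapted_mono _ (@adapted_type_indic n j)); rewrite leq_add2l.
  apply: (measurableT_comp mpos).
  by apply: adapted_info (@info_size _ _ _ _ _ _ X n j) _; rewrite ltn_add2l.
rewrite (past_prod (k := (n * 5 + 4)%N) aW).
- congr (_ * _)%E.
    have g0 x : 0 <= Num.max 0 x :> R by rewrite le_max lexx.
    have := @past_type_size n Z j (fun x => Num.max 0 x) aZ Z0 mpos g0.
    under eq_integral do rewrite (max_r (size_pos_ge0 _ _ _)).
    move=> ->; rewrite -mean_sizeE; congr (_ * _)%E.
    by apply: eq_integral => x _; rewrite maxA maxxx.
  rewrite -(dispatch_mark_law X_law n mS) /distribution /pushforward.
  rewrite -[X in P X]setIT -integral_indic //.
  by rewrite -[X in measurable X]setTI; exact: measurable_funP.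
- move=> B mB.
  have := @info_mark _ _ _ _ _ _ X n (\1_S @^-1` B); apply.
  by rewrite -[X in measurable X]setTI; exact: measurable_indic.
- by move=> t; rewrite !mulr_ge0 // size_pos_ge0.
- by move=> t.
Qed.

(** Gives the chance, whatever the past, that job [n] is small and that the gap after it is long
    enough to clear the system. *)
Lemma past_sizes_tail n (E G : set T) (x : R) :
  (measurable : set (set (pastT (info X) (n * 5).+1))) E ->
  generated_by (job_size X n) G -> 0 < x ->
  P (E `&` G `&` [set t | x < unit_interarrival X n.+1 t]) =
    (P E * P G * (expR (- x))%:E)%E.
Proof.
move=> sE gG x0.
have ind := indep_past (info_measurable X_law) (@info_setI _ _ _ _ _ _ X)
  (@info_setT _ _ _ _ _ _ X) (info_independent X_law).
rewrite (ind (n.+1 * 5)%N).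
- rewrite (ind (n * 5 + 2)%N); last exact: info_sizes.
    by rewrite (exponential_tail (unit_interarrival_law X_law n.+1)).
  by apply: past_gen_mono sE; rewrite addn2.
- apply: (@measurableI _ (pastT (info X) _)).
    by apply: past_gen_mono sE; rewrite mulSn addnC -addn1 leq_add2l.
  apply: sub_sigma_algebra; exists (n * 5 + 2)%N; last exact: info_sizes.
  by rewrite mulSn addnC ltn_add2r.
have := @info_interarrival _ _ _ _ _ _ X n.+1 `]x, +oo[%classic.
rewrite (_ : unit_interarrival X n.+1 @^-1` `]x, +oo[%classic =
  [set t | x < unit_interarrival X n.+1 t]); first by apply; exact: measurable_itv.
by apply/seteqP; split=> t /=; rewrite in_itv /= andbT.
Qed.

Lemma primitives_ae : {ae P, forall t, [/\
  forall n, 0 <= unit_interarrival X n t,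
  forall n j, 0 <= job_size X n j t,
  forall n i j, Defs.variation X n i j t = c j &
  forall n, 0 <= dispatch_mark X n t < 1]}.
Proof.
have t1 : {ae P, forall t, forall n, 0 <= unit_interarrival X n t}.
  by apply: ae_foralln => n; exact: (exponential_ae_ge0 (unit_interarrival_law X_law n)).
have t2 : {ae P, forall t, forall n j, 0 <= job_size X n j t}.
  apply: ae_foralln => n; apply: filter_forall => j.
  have : {ae P, forall t, `[0, +oo[%classic (job_size X n j t)}.
    apply: ae_distribution1 => //; rewrite (job_size_law X_law) //.
    by case: (lawX_mean j).
  by apply: filterS => t /=; rewrite in_itv /= andbT.
have t3 : {ae P, forall t, forall n i j, Defs.variation X n i j t = c j}.
  apply: ae_foralln => n; apply: filter_forall => i; apply: filter_forall => j.
  apply: (@ae_distribution1 _ _ _ _ (Defs.variation X n i j) [set c j]) => //.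
  by rewrite (variation_law X_law).
have t4 : {ae P, forall t, forall n, 0 <= dispatch_mark X n t < 1}.
  apply: ae_foralln => n.
  have : {ae P, forall t, `[0, 1[%classic (dispatch_mark X n t)}.
    apply: ae_distribution1 => //; rewrite (dispatch_mark_law X_law) //.
    rewrite /uniform_prob integral_uniform_pdf.
    rewrite (_ : _ `&` _ = `[0, 1[%classic); last first.
      apply/seteqP; split=> x /=; first by case.
      by rewrite !in_itv /= => /andP[-> /[dup] ? /ltW ->].
    rewrite (eq_integral (cst 1%E)) ?integral_cst //=.
      by rewrite mul1e lebesgue_measure_itv /= lte_fin ltr01 oppr0 adde0.
    move=> x; rewrite inE /= in_itv /= => /andP[x0 /ltW x1].
    by rewrite /uniform_pdf x0 x1 subr0 invr1.
  by apply: filterS => t /=; rewrite in_itv.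
apply: filterS (filterI (filterI t1 t2) (filterI t3 t4)) => t /=.
by case=> -[? ?] [? ?]; split.
Qed.

End model.

(** * Regeneration cycles *)

Section cycles.
Context (R : realType) (dT : measure_display) (T : measurableType dT).
Variables (P : probability T R) (N M : nat).
Variables (p : 'I_M -> R) (lawX lawS : 'I_M -> probability R R).
Variables (r : 'I_N -> 'I_M -> R) (c : 'I_M -> R) (X : primitives P N M).
Hypothesis r_gt0 : forall i j, 0 < r i j.
Hypothesis lawX_mean : forall j, positive_mean_law (lawX j).
Hypothesis X_law : primitives_law X p lawX lawS.
Hypothesis c_ge0 : forall j, 0 <= c j.
Hypothesis lawS_const : forall j, lawS j [set c j] = 1%E.
Variables (q : 'I_M -> {set 'I_N} -> R) (lam : R) (d : nat).
Hypothesis lam_gt0 : 0 < lam.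
Hypothesis q_static : static_policy d q.

Local Notation A t := (arrival_time X lam t).
Local Notation I t := (assigned_set X q t).
Local Notation B t := (processing_time X r t).
Local Notation C n := (in_cycle X r q lam n).

(** The almost sure facts that the sample-path results consume. Identical replicas enter here: a
    processing time is the common size times a constant that depends on type and server. *)
Definition regular_path (t : T) : Prop := [/\ 0 <= A t 0%N,
  forall n, A t n.+1 - A t n = interarrival_pos X n.+1 t / lam,
  forall n i, B t n i =
    size_pos X n (job_type X n t) t * (c (job_type X n t) / r i (job_type X n t))
  & forall n, #|I t n| = d].

Lemma regular_path_ae : {ae P, forall t, regular_path t}.
Proof.
have [q0 qd q1] := q_static.
apply: filterS (primitives_ae lawX_mean X_law lawS_const) => t [t1 t2 t3 t4].
split.
- by rewrite /arrival_time big_ord1 divr_ge0 // ltW.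
- move=> n; rewrite /arrival_time big_ord_recr /= addrAC subrr add0r.
  by rewrite /interarrival_pos max_r.
- move=> n i; rewrite /processing_time t3 /size_pos max_r //; ring.
- move=> n; have /andP[m0 m1] := t4 n; apply: contraTeq isT => Id.
  have : 0 < q (job_type X n t) (I t n).
    by apply: sample_gt0 => //; rewrite enumT -[X in _ < X]/(\sum_J q _ J) q1.
  by rewrite qd ?ltxx.
Qed.

Section regular.
Variable t : T.
Hypothesis reg_t : regular_path t.

Lemma regular_arrival_homo : {homo A t : n m / (n <= m)%N >-> n <= m}.
Proof.
have [_ At _ _] := reg_t; apply: homo_leq => [y|y x z|n]; [exact: lexx|exact: le_trans|].
by rewrite -subr_ge0 At divr_ge0 ?interarrival_pos_ge0 // ltW.
Qed.

Lemma regular_arrival_ge0 n : 0 <= A t n.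
Proof. by have [A0 _ _ _] := reg_t; apply: le_trans A0 (regular_arrival_homo (leq0n n)). Qed.

Lemma regular_processing_ge0 n i : 0 <= B t n i.
Proof.
have [_ _ Bt _] := reg_t; rewrite Bt mulr_ge0 ?size_pos_ge0 // divr_ge0 //.
exact: ltW.
Qed.

Lemma regular_arrival_sum m :
  A t m - A t 0%N = \sum_(n < m) interarrival_pos X n.+1 t / lam.
Proof.
have [_ At _ _] := reg_t; elim: m => [|m IH]; first by rewrite subrr big_ord0.
by rewrite big_ord_recr /= -IH -At; ring.
Qed.

Lemma regular_cycle_length_ge0 : (0 <= cycle_length (A t) (I t) (B t))%E.
Proof.
apply: le_ereal_inf_tmp => _ [n _ <-].
by rewrite lee_fin subr_ge0; exact: regular_arrival_homo.
Qed.

(** The gap after job [n] lies in the cycle exactly when job [n] does, which is known before the gap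
    is drawn; the mean can thus be taken term by term. A path that never returns is excluded, its
    cycle length being +oo whatever the sum of its gaps. *)
Lemma regular_cycle_length : (exists n, ~ C n t) ->
  cycle_length (A t) (I t) (B t) =
  (\sum_(n <oo) (\1_(C n) t * (interarrival_pos X n.+1 t / lam))%:E)%E.
Proof.
move=> Ct; have [m [m0 _ -> Cm]] := cycle_length_return regular_arrival_homo Ct.
have t0 n : 0 <= interarrival_pos X n.+1 t / lam.
  by rewrite divr_ge0 ?interarrival_pos_ge0 // ltW.
rewrite (@nneseries_split _ _ 0 m); last first.
  by move=> k _; rewrite lee_fin mulr_ge0.
rewrite add0n [X in (_ + X)%E]eseries0 ?adde0; last first.
  move=> n mn _; rewrite indicE memNset ?mul0r //.
  by move=> /(Cm n).1; rewrite ltnNge mn.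
rewrite regular_arrival_sum sumEFin big_mkord; congr _%:E.
apply: eq_bigr => n _; rewrite indicE mem_set ?mul1r //.
by apply/(Cm n).2.
Qed.

End regular.

Lemma integral_indic_interarrival n :
  (\int[P]_t (\1_(C n) t * (interarrival_pos X n.+1 t / lam))%:E =
   P (C n) * (mean_interarrival X / lam)%:E)%E.
Proof.
have m0 : 0 <= mean_interarrival X / lam.
  by rewrite divr_ge0 // ltW // (mean_interarrival_gt0 X_law).
have mg : measurable_fun [set: R] (fun x : R => Num.max 0 x / lam).
  by apply: measurable_funM; [exact: measurable_pos|exact: measurable_cst].
have g0 (x : R) : 0 <= Num.max 0 x / lam.
  by rewrite divr_ge0 ?le_max ?lexx // ltW.
have aC : adapted (info X) (n * 5).+1 (\1_(C n) : T -> R).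
  exact: (@measurable_indic _ (pastT (info X) _) R setT _ (@in_cycle_event _ _ _ _ _ _ X r q lam n)).
have C0 t : 0 <= \1_(C n) t :> R by rewrite indicE ler0n.
have := past_interarrival X_law aC C0 mg g0.
rewrite integral_indic ?setIT //; last exact: (in_cycle_measurable X_law).
have posE k t : Num.max 0 (interarrival_pos X k t) = interarrival_pos X k t.
  by rewrite max_r // interarrival_pos_ge0.
under eq_integral do rewrite posE.
move=> -> //; congr (_ * _)%E.
under eq_integral do rewrite posE mulrC EFinM.
rewrite ge0_integralZl_EFin //.
- by rewrite (interarrival_pos_mean X_law) mulrC EFinM.
- by move=> t _; rewrite lee_fin interarrival_pos_ge0.
- by apply/measurable_EFinP; exact: measurable_interarrival_pos.
- by rewrite invr_ge0 ltW.
Qed.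

(** Every [P (C n)] is at least the probability of never returning, so a positive one would make the
    partial sums unbounded. *)
Lemma never_return_negligible (K : R) :
  (forall m, (\sum_(n < m) P (C n) <= K%:E)%E) ->
  {ae P, forall t, exists n, ~ C n t}.
Proof.
move=> HK; exists (\bigcap_n C n); split.
- by apply: bigcapT_measurable => n; exact: (in_cycle_measurable X_law).
- have PC0 : (0 <= P (\bigcap_n C n))%E by [].
  have mbig : measurable (\bigcap_n C n).
    by apply: bigcapT_measurable => n; exact: (in_cycle_measurable X_law).
  have Pfin : P (\bigcap_n C n) \is a fin_num by rewrite fin_num_measure.
  apply/eqP; rewrite eq_le PC0 andbT leNgt; apply/negP => PC.
  have x0 : 0 < fine (P (\bigcap_n C n)) by rewrite fine_gt0 // PC -ge0_fin_numE.
  have [m Hm] : exists m : nat, K < m%:R * fine (P (\bigcap_n C n)).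
    exists (Num.bound `|K / fine (P (\bigcap_n C n))|).
    rewrite -ltr_pdivrMr //; apply: le_lt_trans (ler_norm _) _.
    by apply: archi_boundP.
  have := HK m; apply/negP; rewrite -ltNge.
  apply: (@lt_le_trans _ _ (m%:R * fine (P (\bigcap_n C n)))%:E).
    by rewrite lte_fin.
  rewrite mulr_natl -[m in _ *+ m]card_ord -sumr_const -sumEFin fineK //.
  apply: lee_sum => n _; apply: le_measure; rewrite ?inE //.
    exact: (in_cycle_measurable X_law).
  by move=> t; apply.
- by move=> t /= Ht n _; apply: contrapT => Cn; apply: Ht; exists n.
Qed.

(** The upper half of Wald's identity, [K] bounding the mean number of jobs in a cycle. *)
Lemma mean_cycle_length_le (K : R) :
  (forall m, (\sum_(n < m) P (C n) <= K%:E)%E) ->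
  (\int[P]_t cycle_length (A t) (I t) (B t) <=
   (K * (mean_interarrival X / lam))%:E)%E.
Proof.
move=> HK.
have t0 n t : (0 <= (\1_(C n) t * (interarrival_pos X n.+1 t / lam))%:E)%E.
  by rewrite lee_fin mulr_ge0 // divr_ge0 ?interarrival_pos_ge0 // ltW.
have mt n : measurable_fun setT
    (fun t => (\1_(C n) t * (interarrival_pos X n.+1 t / lam))%:E).
  apply/measurable_EFinP; apply: measurable_funM.
    by apply: measurable_indic; exact: (in_cycle_measurable X_law).
  apply: measurable_funM; [exact: measurable_interarrival_pos|exact: measurable_cst].
have -> : (\int[P]_t cycle_length (A t) (I t) (B t) = \int[P]_t
    \sum_(n <oo) (\1_(C n) t * (interarrival_pos X n.+1 t / lam))%:E)%E.
  apply: ae_eq_integral => //.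
  - exact: (measurable_cycle_length X_law).
  - by apply: ge0_emeasurable_sum => // n.
  apply: filterS (filterI regular_path_ae (never_return_negligible HK)).
  by move=> t [rt Ct] _; exact: regular_cycle_length.
rewrite integral_nneseries //; apply: lime_le.
  by apply: is_cvg_nneseries => n _ _; apply: integral_ge0.
apply: nearW => m /=.
under eq_bigr do rewrite integral_indic_interarrival.
rewrite big_mkord -ge0_sume_distrl //.
rewrite [leRHS]EFinM lee_wpmul2r // lee_fin divr_ge0 // ?ltW //.
exact: (mean_interarrival_gt0 X_law).
Qed.

End cycles.

(** * Replication leaves one server's worth of slack *)

Section replicas.
Context (R : realType) (dT : measure_display) (T : measurableType dT).
Variables (P : probability T R) (N M : nat).
Variables (p : 'I_M -> R) (lawX lawS : 'I_M -> probability R R).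
Variables (r : 'I_N -> 'I_M -> R) (c : 'I_M -> R) (X : primitives P N M).
Hypothesis p_gt0 : forall j, 0 < p j.
Hypothesis r_gt0 : forall i j, 0 < r i j.
Hypothesis lawX_mean : forall j, positive_mean_law (lawX j).
Hypothesis X_law : primitives_law X p lawX lawS.
Hypothesis c_ge0 : forall j, 0 <= c j.
Hypothesis lawS_const : forall j, lawS j [set c j] = 1%E.
Variables (q : 'I_M -> {set 'I_N} -> R) (lam : R) (d : nat).
Hypothesis lam_gt0 : 0 < lam.
Hypothesis d_gt1 : (1 < d)%N.
Hypothesis q_static : static_policy d q.

Local Notation A t := (arrival_time X lam t).
Local Notation I t := (assigned_set X q t).
Local Notation B t := (processing_time X r t).
Local Notation C n := (in_cycle X r q lam n).
Local Notation cycle t := (cycle_length (A t) (I t) (B t)).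
Local Notation S n i := [set t | completes_at (A t) (I t) (B t) n i].
Local Notation regular := (regular_path r c X q lam d).
Local Notation mX := (mean_size lawX).

Hypothesis stable_q : (\int[P]_t cycle t < +oo)%E.

Let useful_size n i j t : R :=
  \1_(C n) t * \1_(S n i) t * (job_type X n t == j)%:R * size_pos X n j t.

Let useful_size_ge0 n i j t : 0 <= useful_size n i j t.
Proof. by rewrite !mulr_ge0 ?size_pos_ge0 // indicE. Qed.

Let mC n : measurable (C n).
Proof. exact: (in_cycle_measurable X_law). Qed.

Let mS n i : measurable (S n i).
Proof.
exact: (past_gen_measurable (info_measurable X_law) (@completes_at_event _ _ _ _ _ _ X r q lam n i)).
Qed.

Let mtype n j : measurable_fun setT (fun t => (job_type X n t == j)%:R : R).
Proof. exact: (adapted_measurable (info_measurable X_law) (@adapted_type_indic _ _ _ _ _ _ X n j)). Qed.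

Let museful n i j : measurable_fun setT (useful_size n i j).
Proof.
apply: measurable_funM; last exact: measurable_size_pos.
apply: measurable_funM; last exact: mtype.
by apply: measurable_funM; exact: measurable_indic.
Qed.

Let e n i j : \bar R := (\int[P]_t (useful_size n i j t)%:E)%E.

Let e_ge0 n i j : (0 <= e n i j)%E.
Proof. by apply: integral_ge0 => t _; rewrite lee_fin. Qed.

Let C0 : \bar R := (\int[P]_t cycle t)%E.

Let ae_cycle_ge0 : {ae P, forall t, 0 <= cycle t}%E.
Proof.
apply: filterS (regular_path_ae r lawX_mean X_law lawS_const lam_gt0 q_static) => t.
exact: regular_cycle_length_ge0.
Qed.

Let le_C0 (G : T -> R) (k : R) : measurable_fun setT G -> (forall t, 0 <= G t) ->
  0 <= k ->
  (forall t, regular t -> ((G t)%:E <= k%:E * cycle t)%E) ->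
  (\int[P]_t (G t)%:E <= k%:E * C0)%E.
Proof.
move=> mG G0 k0 Gle.
have mcyc : measurable_fun setT (fun t => cycle t) by exact: (measurable_cycle_length X_law).
have mmax : measurable_fun setT (fun t => maxe 0 (cycle t))%E.
  by apply: measurable_maxe => //; exact: measurable_cst.
have -> : C0 = (\int[P]_t maxe 0 (cycle t))%E.
  apply: ae_eq_integral => //.
  by apply: filterS ae_cycle_ge0 => t t0 _; rewrite max_r.
rewrite -ge0_integralZl_EFin //; last by move=> t _; rewrite le_max lexx.
apply: ae_ge0_le_integral => //.
- by move=> t _; rewrite lee_fin.
- by apply/measurable_EFinP.
- by move=> t _; rewrite mule_ge0 // le_max lexx.
- exact: emeasurable_funM.
apply: filterS (regular_path_ae r lawX_mean X_law lawS_const lam_gt0 q_static) => t rt _.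
by rewrite (le_trans (Gle t rt)) // lee_wpmul2l // le_max lexx orbT.
Qed.

Let in_cycle_indicE n t : \1_(C n) t = (`[< C n t >])%:R :> R.
Proof.
by rewrite indicE (_ : (t \in _) = `[< C n t >]) //; apply/idP/asboolP; rewrite inE.
Qed.

Let SE n i t : \1_(S n i) t = (completes_at (A t) (I t) (B t) n i)%:R :> R.
Proof.
rewrite indicE (_ : (t \in _) = completes_at (A t) (I t) (B t) n i) //.
by apply/idP/idP; rewrite inE.
Qed.

Let work m i t : R :=
  \sum_(n < m) \sum_j useful_size n i j t * (c j / r i j).

Let work_regular m i t : regular t ->
  work m i t = \sum_(n < m) \1_(C n) t *
    ((completes_at (A t) (I t) (B t) n i)%:R * B t n i).
Proof.
move=> [_ _ Bt _]; apply: eq_bigr => n _.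
rewrite (bigD1 (job_type X n t)) //= big1 ?addr0.
  by rewrite Bt /useful_size eqxx SE mulr1 -!mulrA.
move=> j jt; rewrite /useful_size (negbTE (_ : _ != j)) ?mulr0 ?mul0r //.
by rewrite eq_sym.
Qed.

(** The horizon [m] may fall on either side of the end [k] of the cycle, so both sums are extended
    to [maxn m k]. *)
Let work_le_useful m i t : regular t -> forall k,
  (forall n, C n t <-> (n < k)%N) -> work m i t <= useful (A t) (I t) (B t) k i.
Proof.
move=> rt k Ck; rewrite work_regular //.
have B0 n j : 0 <= B t n j by exact: (regular_processing_ge0 r_gt0 c_ge0 rt).
pose F n := \1_(C n) t * ((completes_at (A t) (I t) (B t) n i)%:R * B t n i).
have -> : useful (A t) (I t) (B t) k i = \sum_(n < maxn m k) F n.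
  rewrite /useful (big_ord_widen _ (fun n => (completes_at (A t) (I t) (B t) n i)%:R * B t n i)
    (leq_maxr m k)) big_mkcond /=.
  apply: eq_bigr => n _; rewrite /F in_cycle_indicE.
  case: asboolP => [/Ck -> |nC]; first by rewrite mul1r.
  by case: ifP => [/Ck//|_]; rewrite mul0r.
rewrite (big_ord_widen _ F (leq_maxl m k)) big_mkcond /=.
apply: ler_sum => n _; case: ifP => // _.
by rewrite /F; apply: mulr_ge0; [|apply: mulr_ge0]; rewrite ?indicE //; exact: B0.
Qed.

Let work_le m i t : regular t -> ((work m i t)%:E <= 1%:E * cycle t)%E.
Proof.
move=> rt; rewrite mul1e.
have [ex|nex] := pselect (exists n, ~ C n t); last first.
  rewrite cycle_length_no_return ?leey // => n.
  by apply: contrapT => Cn; apply: nex; exists n.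
have [k [k0 Ek -> Ck]] := cycle_length_return (regular_arrival_homo lam_gt0 rt) ex.
rewrite lee_fin (le_trans (work_le_useful _ _ rt Ck)) //.
apply: useful_server_empty => //.
- exact: (regular_arrival_ge0 lam_gt0 rt).
- by move=> n; exact: (regular_arrival_homo lam_gt0 rt).
- by case: rt => _ _ _ It n; rewrite It.
Qed.

Let work_total_le m (i0 : 'I_N) t : regular t ->
  ((\sum_i work m i t)%:E <= N.-1%:R%:E * cycle t)%E.
Proof.
move=> rt.
(* For an infinite cycle the bound must be +oo, whereas 0 times +oo is 0. *)
have N1 : (0 < N.-1)%N.
  have [_ _ _ It] := rt.
  have := max_card (mem (I t 0%N)); rewrite It card_ord => dN.
  by rewrite -ltnS (leq_trans d_gt1) // (leq_trans dN) // leqSpred.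
have [ex|nex] := pselect (exists n, ~ C n t); last first.
  rewrite cycle_length_no_return ?gt0_muley ?leey ?lte_fin ?ltr0n // => n.
  by apply: contrapT => Cn; apply: nex; exists n.
have [k [k0 Ek -> Ck]] := cycle_length_return (regular_arrival_homo lam_gt0 rt) ex.
rewrite lee_fin.
apply: (@le_trans _ _ (\sum_i useful (A t) (I t) (B t) k i)).
  by apply: ler_sum => i _; exact: work_le_useful.
apply: useful_total_empty => //.
- exact: (regular_arrival_ge0 lam_gt0 rt).
- by move=> n; exact: (regular_arrival_homo lam_gt0 rt).
- by case: rt => _ _ _ It n; rewrite It.
Qed.

Let cr_ge0 i j : 0 <= c j / r i j.
Proof. by rewrite divr_ge0 // ltW. Qed.

Let integral_work m i : (\int[P]_t (work m i t)%:E =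
  \sum_(n < m) \sum_j e n i j * (c j / r i j)%:E)%E.
Proof.
under eq_integral do rewrite -sumEFin.
rewrite ge0_integral_sum //; last first.
- move=> n t _; rewrite lee_fin sumr_ge0 // => j _.
  by rewrite mulr_ge0.
- move=> n; apply/measurable_EFinP; apply: measurable_sum => j.
  by apply: measurable_funM => //; exact: measurable_cst.
apply: eq_bigr => n _.
under eq_integral do rewrite -sumEFin.
rewrite ge0_integral_sum //; last first.
- by move=> j t _; rewrite lee_fin mulr_ge0.
- move=> j; apply/measurable_EFinP.
  by apply: measurable_funM => //; exact: measurable_cst.
apply: eq_bigr => j _.
under eq_integral do rewrite EFinM.
rewrite ge0_integralZr //.
- exact/measurable_EFinP.
- by move=> t _; rewrite lee_fin.
- by rewrite lee_fin.
Qed.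

Let mwork m i : measurable_fun setT (work m i).
Proof.
apply: measurable_sum => n; apply: measurable_sum => j.
by apply: measurable_funM => //; exact: measurable_cst.
Qed.

Let work_ge0 m i t : 0 <= work m i t.
Proof. by apply: sumr_ge0 => n _; apply: sumr_ge0 => j _; rewrite mulr_ge0. Qed.

(** Which server completes a job may depend on its size, so the single terms do not factor. Summed
    over the servers the credit is 1, and the type and size are independent of [C n]. *)
Let e_sum n j : (\sum_i e n i j = P (C n) * (p j * mX j)%:E)%E.
Proof.
rewrite -ge0_integral_sum //; last first.
- by move=> i t _; rewrite lee_fin.
- by move=> i; apply/measurable_EFinP.
pose h t : R := \1_(C n) t * (job_type X n t == j)%:R * Num.max 0 (size_pos X n j t).
have mpos := @measurable_pos R.
transitivity (\int[P]_t (h t)%:E)%E.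
  apply: ge0_ae_eq_integral => //.
  - apply: emeasurable_sum => i; exact/measurable_EFinP.
  - apply/measurable_EFinP; apply: measurable_funM.
      by apply: measurable_funM => //; exact: measurable_indic.
    by apply: (measurableT_comp mpos); exact: measurable_size_pos.
  - by move=> t _; apply: sume_ge0 => i _; rewrite lee_fin.
  - by move=> t _; rewrite lee_fin !mulr_ge0 ?le_max ?lexx // indicE.
  apply: filterS (regular_path_ae r lawX_mean X_law lawS_const lam_gt0 q_static) => t rt _.
  rewrite sumEFin; congr _%:E.
  under eq_bigr => i _ do rewrite /useful_size SE -!mulrA mulrCA.
  rewrite -mulr_suml completes_at_sum ?mul1r.
    by rewrite /h max_r ?mulrA // size_pos_ge0.
  by case: rt => _ _ _ It; rewrite -cards_eq0 It -lt0n ltnW.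
have aC : adapted (info X) (n * 5).+1 (\1_(C n) : T -> R).
  exact: (@measurable_indic _ (pastT (info X) _) R setT _ (@in_cycle_event _ _ _ _ _ _ X r q lam n)).
have Cge0 t : 0 <= \1_(C n) t :> R by rewrite indicE.
have g0 (x : R) : 0 <= Num.max 0 x by rewrite le_max lexx.
rewrite (past_type_size X_law j aC Cge0 mpos g0) integral_indic ?setIT //.
under eq_integral do rewrite maxA maxxx.
by rewrite (mean_sizeE lawX_mean) EFinM muleA.
Qed.

Let e_fin n i j : e n i j \is a fin_num.
Proof.
rewrite ge0_fin_numE //.
apply: (@le_lt_trans _ _ (\sum_i e n i j)%E).
  by rewrite (bigD1 i) //= leeDl // sume_ge0.
rewrite e_sum ltey_eq fin_numM // fin_num_measure //.
Qed.

Let V m : R := \sum_(n < m) fine (P (C n)).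

Let V_E m : (\sum_(n < m) P (C n) = (V m)%:E)%E.
Proof.
rewrite /V -sumEFin; apply: eq_bigr => n _; rewrite fineK //.
by rewrite fin_num_measure.
Qed.

Let C0_ge0 : (0 <= C0)%E.
Proof.
have -> : C0 = (\int[P]_t maxe 0 (cycle t))%E.
  have mcyc : measurable_fun setT (fun t => cycle t) by exact: (measurable_cycle_length X_law).
  apply: ae_eq_integral => //.
    by apply: measurable_maxe => //; exact: measurable_cst.
  by apply: filterS ae_cycle_ge0 => t t0 _; rewrite max_r.
by apply: integral_ge0 => t _; rewrite le_max lexx.
Qed.

Let C0_fin : C0 \is a fin_num.
Proof. by rewrite ge0_fin_numE. Qed.

(** If every horizon failed, the partial sums [V m] would be bounded by [lam * fine C0 / (L *
    mean_interarrival X)] and the bound on the mean cycle length would read [C0 <= C0 / L]. This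
    forces [C0] to vanish, and then the horizon 1 works. *)
Let exists_horizon (L : R) : 1 < L -> exists m,
  0 < V m /\ lam * fine C0 <= L * mean_interarrival X * V m.
Proof.
move=> L1; have L0 : 0 < L by lra.
have mt0 := mean_interarrival_gt0 X_law.
have V1 : V 1 = 1.
  rewrite /V big_ord1 (_ : C 0 = setT) ?probability_setT //.
  by apply/seteqP; split => // t _ [].
apply: contrapT => nex.
have H m : (\sum_(n < m) P (C n) <= (lam * fine C0 / (L * mean_interarrival X))%:E)%E.
  rewrite V_E lee_fin ler_pdivlMr ?mulr_gt0 // mulrC.
  have V0 : 0 <= V m by apply: sumr_ge0 => n _; rewrite fine_ge0.
  move: V0; rewrite le_eqVlt => /orP[/eqP <-|V0].
    by rewrite mulr0 mulr_ge0 ?fine_ge0 // ltW.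
  rewrite leNgt; apply/negP => lt; apply: nex; exists m; split => //.
  exact: ltW.
have := mean_cycle_length_le lawX_mean X_law lawS_const lam_gt0 q_static H.
rewrite -/C0 -(fineK C0_fin) lee_fin.
have -> : lam * fine C0 / (L * mean_interarrival X) * (mean_interarrival X / lam) = fine C0 / L.
  by field; rewrite !gt_eqF.
rewrite ler_pdivlMr // => C0L.
have C00 : fine C0 = 0.
  have : 0 <= fine C0 by rewrite fine_ge0.
  by move: C0L; nra.
apply: nex; exists 1%N; rewrite V1 C00 mulr0 mulr1 ltr01; split => //.
by rewrite mulr_ge0 // ltW.
Qed.

(* The size-weighted frequency with which server [i] is the one to complete the
   type-[j] jobs of a cycle defines a policy without replication, and its loads
   are the useful work per unit of time that the servers do. *)
Lemma replicas_split (L : R) (i0 : 'I_N) : 1 < L -> exists w : 'I_N -> 'I_M -> R,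
  [/\ forall i j, 0 <= w i j, forall j, \sum_i w i j = 1,
      forall i, lam * \sum_j w i j * p j * mX j * c j / r i j <= L * mean_interarrival X &
      lam * \sum_i \sum_j w i j * p j * mX j * c j / r i j <=
        N.-1%:R * L * mean_interarrival X].
Proof.
move=> L1; have [m [V0 HV]] := exists_horizon L1.
have pm0 j : 0 < p j * mX j by rewrite mulr_gt0 // mean_size_gt0.
pose a i j : R := \sum_(n < m) fine (e n i j).
have a0 i j : 0 <= a i j by apply: sumr_ge0 => n _; rewrite fine_ge0.
have a_sum j : \sum_i a i j = V m * (p j * mX j).
  rewrite /a exchange_big /= /V mulr_suml; apply: eq_bigr => n _.
  apply: EFin_inj; rewrite -sumEFin EFinM fineK ?fin_num_measure // -e_sum.
  by apply: eq_bigr => i _; rewrite fineK.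
have a_work i : (\int[P]_t (work m i t)%:E = (\sum_j a i j * (c j / r i j))%:E)%E.
  rewrite integral_work exchange_big /= -sumEFin; apply: eq_bigr => j _.
  rewrite /a mulr_suml -sumEFin; apply: eq_bigr => n _.
  by rewrite [RHS]EFinM fineK.
have a_le i : \sum_j a i j * (c j / r i j) <= fine C0.
  rewrite -lee_fin -a_work fineK // -[leRHS]mul1e.
  by apply: le_C0 => // t; exact: work_le.
have a_tot : \sum_i \sum_j a i j * (c j / r i j) <= N.-1%:R * fine C0.
  rewrite -lee_fin EFinM fineK // -sumEFin.
  under eq_bigr do rewrite -a_work.
  rewrite -ge0_integral_sum //.
  - under eq_integral do rewrite sumEFin.
    apply: le_C0 => //.
    + exact: measurable_sum.
    + by move=> t; exact: sumr_ge0.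
    + by move=> t; exact: work_total_le.
  - by move=> i; apply/measurable_EFinP.
  - by move=> i t _; rewrite lee_fin.
(* By [a_sum] the denominator is the mean type-[j] size that the cycle brings within the horizon. *)
pose w i j := a i j / (V m * (p j * mX j)).
have wE i j : w i j * p j * mX j * c j / r i j = a i j * (c j / r i j) / V m.
  rewrite /w; field; rewrite !gt_eqF //.
  exact: mean_size_gt0.
exists w; split.
- by move=> i j; rewrite divr_ge0 // mulr_ge0 // ltW.
- move=> j; rewrite -mulr_suml a_sum divff // mulf_neq0 ?gt_eqF //.
- move=> i; under eq_bigr do rewrite wE.
  rewrite -mulr_suml mulrA ler_pdivrMr //.
  by apply: le_trans HV; rewrite ler_pM2l.
under eq_bigr do under eq_bigr do rewrite wE.
under eq_bigr do rewrite -mulr_suml.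
rewrite -mulr_suml mulrA ler_pdivrMr // -!mulrA (mulrA L).
apply: (@le_trans _ _ (N.-1%:R * (lam * fine C0))).
  by rewrite mulrCA ler_pM2l.
by rewrite ler_wpM2l.
Qed.

End replicas.

(** * The Huber function *)

Section huber.
Context (R : realType).
Implicit Types H w b s x : R.

Definition huber H x : R := if x <= H then x ^+ 2 / (2 * H) else x - H / 2.
(** The derivative of [huber]. It equals 1 from [H] on, so its mean bounds the probability of a
    large workload. *)
Definition huber_slope H x : R := Num.min (x / H) 1.
(** Second-order error of a step of size [x]: quadratic for small steps, linear for large ones,
    hence of finite mean as soon as the step has one. *)
Definition huber_gap H x : R := Num.min (x ^+ 2 / (2 * H)) (2 * x).

Lemma huber_ge0 H x : 0 < H -> 0 <= x -> 0 <= huber H x.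
Proof.
move=> H0 x0; rewrite /huber; case: ifPn => [_|].
  by rewrite divr_ge0 ?sqr_ge0 // mulr_ge0 // ltW.
by rewrite -ltNge; lra.
Qed.

Lemma huber_slope_ge0 H x : 0 < H -> 0 <= x -> 0 <= huber_slope H x.
Proof. by move=> H0 x0; rewrite le_min ler01 divr_ge0 // ltW. Qed.

Lemma huber_slope_le1 H x : huber_slope H x <= 1.
Proof. by rewrite ge_min lexx orbT. Qed.

Lemma huber_slope1 H x : 0 < H -> H <= x -> huber_slope H x = 1.
Proof. by move=> H0 Hx; rewrite /huber_slope min_r // ler_pdivlMr // mul1r. Qed.

Lemma huber_gap_ge0 H x : 0 < H -> 0 <= x -> 0 <= huber_gap H x.
Proof.
by move=> H0 x0; rewrite le_min divr_ge0 ?sqr_ge0 ?mulr_ge0 // ltW.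
Qed.

Lemma huber_gap_homo H x y : 0 < H -> 0 <= x -> x <= y ->
  huber_gap H x <= huber_gap H y.
Proof.
move=> H0 x0 xy; rewrite /huber_gap le_min !ge_min; apply/andP; split; apply/orP.
  by left; rewrite ler_pM2r ?invr_gt0 ?mulr_gt0 // lerXn2r ?nnegrE // (le_trans x0).
by right; rewrite ler_pM2l.
Qed.

(* The Huber function is the infimum over [u] of [(x - u)^2 / 2H + |u|]; the
   optimal [u] at [w] bounds its value at [x]. *)
Lemma huber_le_quadratic H w x : 0 < H -> 0 <= w -> 0 <= x ->
  huber H x <= huber H w + huber_slope H w * (x - w) + (x - w) ^+ 2 / (2 * H).
Proof.
move=> H0 w0 x0; pose k := H^-1; have k0 : 0 < k by rewrite invr_gt0.
have kH : k * H = 1 by rewrite mulVf // gt_eqF.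
have e2 z : z / (2 * H) = z * k / 2 by rewrite invfM /k; ring.
rewrite /huber /huber_slope !e2 -/k; have [wH|wH] := leP w H.
  rewrite min_l; last by rewrite ler_pdivrMr // mul1r.
  case: ifPn => [xH|]; first by rewrite -/k; nra.
  rewrite -ltNge => xH; rewrite -/k.
  suff : 0 <= k * (x - H) ^+ 2 by nra.
  by rewrite mulr_ge0 ?sqr_ge0 // ltW.
rewrite min_r; last by rewrite ler_pdivlMr // mul1r ltW.
case: ifPn => [xH|_]; last first.
  have : 0 <= (x - w) ^+ 2 * k by rewrite mulr_ge0 ?sqr_ge0 // ltW.
  by lra.
have : 0 <= (w - H) * k * (w + H - 2 * x).
  by rewrite !mulr_ge0 //; [lra|exact: ltW|lra].
by nra.
Qed.

Lemma huber_le_lipschitz H w x : 0 < H -> 0 <= w -> 0 <= x ->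
  huber H x <= huber H w + `|x - w|.
Proof.
move=> H0 w0 x0; pose k := H^-1; have k0 : 0 < k by rewrite invr_gt0.
have kH : k * H = 1 by rewrite mulVf // gt_eqF.
have e2 z : z / (2 * H) = z * k / 2 by rewrite invfM /k; ring.
have [xw|wx] := leP x w.
  apply: (@le_trans _ _ (huber H w)); last by rewrite lerDl.
  rewrite /huber !e2; have [wH|wH] := leP w H.
    by rewrite (le_trans xw wH); nra.
  case: ifPn => [xH|_]; last lra.
  have : x * x * k <= H by have := mulr_ge0 x0 (ltW k0); nra.
  by lra.
rewrite ger0_norm ?subr_ge0 ?(ltW wx) // /huber !e2; have [wH|wH] := leP w H.
  case: ifPn => [xH|].
    have : (x - w) * (x + w) * k <= (x - w) * 2.
      rewrite -mulrA ler_wpM2l //; first by lra.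
      have : (2 * H - (x + w)) * k >= 0 by rewrite mulr_ge0 //; [lra|exact: ltW].
      by nra.
    by nra.
  rewrite -ltNge => xH; have : 0 <= (H - w) ^+ 2 * k by rewrite mulr_ge0 ?sqr_ge0 // ltW.
  by nra.
by case: ifPn => [xH|_]; lra.
Qed.

(** Reflection at 0 does no harm, since the right side is nonnegative for negative [x]: it is
    [x ^+ 2 / (2 * H)] when [w <= H], and completing a square shows it to be at least [w - H]
    otherwise. *)
Lemma huber_pos_le_quadratic H w x : 0 < H -> 0 <= w ->
  huber H (Num.max 0 x) <=
    huber H w + huber_slope H w * (x - w) + (x - w) ^+ 2 / (2 * H).
Proof.
move=> H0 w0; have [x0|x0] := leP 0 x; first exact: huber_le_quadratic.
pose k := H^-1; have k0 : 0 < k by rewrite invr_gt0.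
have kH : k * H = 1 by rewrite mulVf // gt_eqF.
have e2 z : z / (2 * H) = z * k / 2 by rewrite invfM /k; ring.
rewrite /huber /huber_slope !e2 -/k (ltW H0) expr0n !mul0r.
have [wH|wH] := leP w H.
  rewrite min_l; last by rewrite ler_pdivrMr // mul1r.
  have : 0 <= x ^+ 2 * k by rewrite mulr_ge0 ?sqr_ge0 // ltW.
  by rewrite -/k; lra.
rewrite min_r; last by rewrite ler_pdivlMr // mul1r ltW.
have : 0 <= (H + x - w) ^+ 2 * k by rewrite mulr_ge0 ?sqr_ge0 // ltW.
have -> : (H + x - w) ^+ 2 * k =
    H * (k * H) + 2 * (x - w) * (k * H) + (x - w) ^+ 2 * k by ring.
by rewrite kH; lra.
Qed.

(** The slope carries the drift, and the error depends on [b] and [s] alone, not on the workload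
    [w]. The two branches of the gap come from the quadratic and the Lipschitz bound. *)
Lemma huber_step H w b s : 0 < H -> 0 <= w -> 0 <= b -> 0 <= s ->
  huber H (Num.max 0 (w + b - s)) + huber_slope H w * s <=
  huber H w + huber_slope H w * b + huber_gap H b + huber_gap H s.
Proof.
move=> H0 w0 b0 s0; set x := Num.max 0 _; pose y := Num.max b s.
have y0 : 0 <= y by rewrite le_max b0.
have by_ : b <= y by rewrite le_max lexx.
have sy : s <= y by rewrite le_max lexx orbT.
have gapy : huber_gap H y <= huber_gap H b + huber_gap H s.
  have gb := huber_gap_ge0 H0 b0; have gs := huber_gap_ge0 H0 s0.
  by rewrite /y; case: (leP b s) => _; lra.
suff : huber H x <= huber H w + huber_slope H w * (b - s) + huber_gap H y by lra.
have sl0 := huber_slope_ge0 H0 w0; have sl1 := huber_slope_le1 H w.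
rewrite -lerBlDl le_min; apply/andP; split; rewrite lerBlDl.
  have := huber_pos_le_quadratic (w + b - s) H0 w0; rewrite -/x.
  have -> : w + b - s - w = b - s by ring.
  have : (b - s) ^+ 2 / (2 * H) <= y ^+ 2 / (2 * H).
    by rewrite ler_pM2r ?invr_gt0 ?mulr_gt0 //; nra.
  by lra.
have x0 : 0 <= x by rewrite le_max lexx.
have := huber_le_lipschitz H0 w0 x0.
have : `|x - w| <= `|b - s|.
  have := ler_norm (b - s); have := ler_norm (- (b - s)); rewrite normrN.
  by rewrite ler_norml /x; case: (leP 0 (w + b - s)) => ?; rewrite ?sub0r; lra.
have : `|b - s| <= y by rewrite ler_norml; lra.
have : - (huber_slope H w * (b - s)) <= y by nra.
by lra.
Qed.

Lemma huber0 H : 0 < H -> huber H 0 = 0.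
Proof. by move=> H0; rewrite /huber ltW // expr0n mul0r. Qed.

Lemma measurable_huber H : measurable_fun [set: R] (huber H).
Proof.
have m1 : measurable_fun [set: R] (fun x : R => x <= H).
  by apply: measurable_fun_ler => //; exact: measurable_cst.
have m2 : measurable_fun [set: R] (fun x : R => x ^+ 2 / (2 * H)).
  by apply: measurable_funM.
have m3 : measurable_fun [set: R] (fun x : R => x - H / 2).
  by apply: measurable_funB.
exact: (measurable_fun_if measurableT m1 (measurable_funTS m2) (measurable_funTS m3)).
Qed.

Lemma measurable_huber_slope H : measurable_fun [set: R] (huber_slope H).
Proof. by apply: measurable_minr => //; apply: measurable_funM. Qed.

Lemma measurable_huber_gap H : measurable_fun [set: R] (huber_gap H).
Proof.
by apply: measurable_minr; apply: measurable_funM.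
Qed.

(** This is where a first moment is enough: the gaps vanish pointwise as [H] grows and are dominated
    by [2 * f]. *)
Lemma huber_gap_integral_cvg d (T : measurableType d) (mu : {measure set T -> \bar R})
    (f : T -> R) : measurable_fun setT f -> (forall t, 0 <= f t) ->
  (\int[mu]_t (f t)%:E < +oo)%E ->
  ((\int[mu]_t (huber_gap n.+1%:R (f t))%:E)%E @[n --> \oo] --> 0%E).
Proof.
move=> mf f0 foo.
have H0 n : 0 < n.+1%:R :> R by rewrite ltr0n.
have mg n : measurable_fun setT (fun t => (huber_gap n.+1%:R (f t))%:E).
  by apply/measurable_EFinP; apply: (measurableT_comp (measurable_huber_gap _)).
have cvg0 t : (huber_gap n.+1%:R (f t))%:E @[n --> \oo] --> 0%E.
  apply/fine_cvgP; split; first exact: nearW.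
  apply: (@squeeze_cvgr _ _ _ _ (cst 0) (fun n => (f t ^+ 2 / 2) * n.+1%:R^-1)).
  - apply: nearW => n /=; rewrite huber_gap_ge0 //= /huber_gap ge_min.
    by rewrite invfM mulrA lexx.
  - exact: cvg_cst.
  rewrite -[X in _ --> X](mulr0 (f t ^+ 2 / 2)); apply: cvgMr.
  exact: cvg_harmonic.
have ig : mu.-integrable setT (fun t => (2 * f t)%:E).
  apply/integrableP; split.
    by apply/measurable_EFinP; exact: measurable_funM.
  under eq_integral do rewrite abse_EFin ger0_norm ?mulr_ge0 //.
  under eq_integral do rewrite EFinM.
  rewrite ge0_integralZl_EFin //.
  - by rewrite lte_mul_pinfty.
  - by move=> t _; rewrite lee_fin.
  - exact/measurable_EFinP.
have dom t n : (`|(huber_gap n.+1%:R (f t))%:E| <= (2 * f t)%:E)%E.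
  rewrite /= ger0_norm ?huber_gap_ge0 // lee_fin.
  by rewrite /huber_gap ge_min lexx orbT.
have := @dominated_convergence _ T R mu setT measurableT
  (fun n t => (huber_gap n.+1%:R (f t))%:E) (cst 0%E)
  (fun t => (2 * f t)%:E) mg (measurable_cst _)
  (aeW mu (fun t _ => cvg0 t)) ig (aeW mu (fun t n _ => dom t n)).
by case=> _ _; rewrite integral_cst // mul0e.
Qed.
End huber.

(** * Stability without replication *)

Section single_server.
Context (R : realType) (dT : measure_display) (T : measurableType dT).
Variables (P : probability T R) (N M : nat).
Variables (p : 'I_M -> R) (lawX lawS : 'I_M -> probability R R).
Variables (r : 'I_N -> 'I_M -> R) (c : 'I_M -> R) (X : primitives P N M).
Hypothesis p_gt0 : forall j, 0 < p j.
Hypothesis p_sum1 : \sum_(j < M) p j = 1.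
Hypothesis r_gt0 : forall i j, 0 < r i j.
Hypothesis lawX_mean : forall j, positive_mean_law (lawX j).
Hypothesis X_law : primitives_law X p lawX lawS.
Hypothesis c_ge0 : forall j, 0 <= c j.
Hypothesis lawS_const : forall j, lawS j [set c j] = 1%E.
Variables (w : 'I_N -> 'I_M -> R) (lam : R).
Hypothesis w_ge0 : forall i j, 0 <= w i j.
Hypothesis w_sum : forall j, \sum_i w i j = 1.
Hypothesis lam_gt0 : 0 < lam.

Definition single_policy (j : 'I_M) (J : {set 'I_N}) : R :=
  \sum_i (J == finset.set1 i)%:R * w i j.

Lemma single_policy_set1 j i : single_policy j (finset.set1 i) = w i j.
Proof.
rewrite /single_policy (bigD1 i) //= eqxx mul1r big1 ?addr0 // => k ki.
rewrite (negbTE (_ : _ != _)) ?mul0r //; apply: contra ki => /eqP e.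
by rewrite (finset.set1_inj e).
Qed.

Lemma single_policy_static : static_policy 1 single_policy.
Proof.
split.
- by move=> j J; apply: sumr_ge0 => i _; rewrite mulr_ge0.
- move=> j J J1; apply: big1 => i _.
  have [e|_] := eqVneq J (finset.set1 i); last by rewrite mul0r.
  by rewrite e cards1 in J1.
move=> j; rewrite exchange_big /= -[RHS](w_sum j); apply: eq_bigr => i _.
rewrite (bigD1 (finset.set1 i)) //= eqxx mul1r big1 ?addr0 // => J.
by move=> /negbTE ->; rewrite mul0r.
Qed.

Local Notation q := single_policy.
Local Notation A t := (arrival_time X lam t).
Local Notation I t := (assigned_set X q t).
Local Notation B t := (processing_time X r t).
Local Notation C n := (in_cycle X r q lam n).
Local Notation cycle t := (cycle_length (A t) (I t) (B t)).
Local Notation regular := (regular_path r c X q lam 1).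
Local Notation mX := (mean_size lawX).
Local Notation adp := (adapted (info X)).
Local Notation tau n t := (interarrival_pos X n t).
Local Notation sz n j t := (size_pos X n j t).
Local Notation W n i t := (workload (A t) (I t) (B t) n i).

Let mark_set (i : 'I_N) (j : 'I_M) : set R :=
  [set u | sample (finset.set0 : {set 'I_N}) (q j) (enum {: {set 'I_N}}) u == finset.set1 i].

Let mmark i j : measurable (mark_set i j).
Proof.
have mS := @measurable_sample R _ (finset.set0 : {set 'I_N}) (q j)
  (enum {: {set 'I_N}}) (finset.set1 i).
by rewrite -[X in measurable X]setTI; exact: mS.
Qed.

Let uniform_mark i j : (uniform_prob (@ltr01 R) (mark_set i j) <= (w i j)%:E)%E.
Proof.
have [q0 _ q1] := single_policy_static.
rewrite -single_policy_set1; apply: uniform_sample => //.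
- exact: enum_uniq.
- by rewrite mem_enum.
- by rewrite big_enum q1.
Qed.

Let cr_ge0 i j : 0 <= c j / r i j.
Proof. by rewrite divr_ge0 // ltW. Qed.

(** Written through the dispatch mark rather than the assigned set, in the form that the
    independence of the sources can factor. *)
Let brought n i j t : R :=
  (job_type X n t == j)%:R * sz n j t * \1_(mark_set i j) (dispatch_mark X n t).

Let brought_ge0 n i j t : 0 <= brought n i j t.
Proof. by rewrite !mulr_ge0 ?size_pos_ge0 // indicE. Qed.

Let work n i t : R := \sum_j brought n i j t * (c j / r i j).

Let work_ge0 n i t : 0 <= work n i t.
Proof. by apply: sumr_ge0 => j _; rewrite mulr_ge0. Qed.

Let regular_work n i t : regular t -> (i \in I t n)%:R * B t n i = work n i t.
Proof.
move=> [_ _ Bt It]; have /eqP/cards1P[s Is] := It n.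
rewrite /work (bigD1 (job_type X n t)) //= big1 ?addr0; last first.
  move=> j jt; rewrite /brought (negbTE (_ : _ != j)) ?mul0r //.
  by rewrite eq_sym.
rewrite /brought eqxx mul1r Bt (_ : (\1_ _) _ = (i \in I t n)%:R) //.
  by rewrite -mulrA mulrCA.
rewrite indicE (_ : (_ \in mark_set _ _) = (i \in I t n)) //.
have -> : (i \in I t n) = (I t n == finset.set1 i).
  rewrite Is inE; apply/eqP/eqP => [->//|e].
  by rewrite (finset.set1_inj e).
by apply/idP/idP; rewrite inE.
Qed.

Let regularS n i t : regular t ->
  W n.+1 i t = Num.max 0 (W n i t + work n i t - tau n.+1 t / lam).
Proof.
move=> rt; have [_ At _ It] := rt; have /eqP/cards1P[s Is] := It n.
rewrite -regular_work // -At; apply: (workloadS i Is).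
- exact: (regular_processing_ge0 r_gt0 c_ge0 rt).
- exact: (regular_arrival_homo lam_gt0 rt).
Qed.

Let W_ge0 n i t : 0 <= W n i t.
Proof. by rewrite le_max lexx. Qed.

Let adapted_W n i : adp (n * 5).+1 (fun t => W n i t).
Proof.
apply: (@measurable_maxr _ (pastT (info X) _) R); first exact: measurable_cst.
apply: (@measurable_funB _ (pastT (info X) _) R).
  by refine (adapted_mono _ (@adapted_clear _ _ _ _ _ _ X r q lam n i)); rewrite leqW.
exact: adapted_arrival.
Qed.

Let adapted_C n : adp (n * 5).+1 (\1_(C n) : T -> R).
Proof.
exact: (@measurable_indic _ (pastT (info X) _) R setT _ (@in_cycle_event _ _ _ _ _ _ X r q lam n)).
Qed.

Let C_ge0 n t : 0 <= \1_(C n) t :> R.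
Proof. by rewrite indicE. Qed.

Let mC n : measurable (C n).
Proof. exact: (in_cycle_measurable X_law). Qed.

Let adapted_meas k (f : T -> R) : adp k f -> measurable_fun setT f.
Proof. by move=> af; exact: (adapted_measurable (info_measurable X_law) af). Qed.

Let mtype n j : measurable_fun setT (fun t => (job_type X n t == j)%:R : R).
Proof. exact: (adapted_meas (@adapted_type_indic _ _ _ _ _ _ X n j)). Qed.

(** * Drift of the Huber function at one server *)

Section drift.
Variables (i : 'I_N) (H : R).
Hypothesis H_gt0 : 0 < H.

Let slope n t : R := huber_slope H (W n i t) * \1_(C n) t.
Let height n t : R := huber H (W n i t) * \1_(C n) t.
Let gap_size j (x : R) : R := huber_gap H (Num.max 0 x * (c j / r i j)).
Let gap_time (x : R) : R := huber_gap H (Num.max 0 x / lam).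

Let max0_ge0 (x : R) : 0 <= Num.max 0 x.
Proof. by rewrite le_max lexx. Qed.

Let gap_size_ge0 j x : 0 <= gap_size j x.
Proof. by apply: huber_gap_ge0 => //; rewrite mulr_ge0. Qed.

Let gap_time_ge0 x : 0 <= gap_time x.
Proof. by apply: huber_gap_ge0 => //; rewrite divr_ge0 // ltW. Qed.

Let mgap_size j : measurable_fun [set: R] (gap_size j).
Proof.
apply: (measurableT_comp (@measurable_huber_gap R H)).
by apply: measurable_funM; [exact: measurable_pos|exact: measurable_cst].
Qed.

Let mgap_time : measurable_fun [set: R] gap_time.
Proof.
apply: (measurableT_comp (@measurable_huber_gap R H)).
by apply: measurable_funM; [exact: measurable_pos|exact: measurable_cst].
Qed.

Let slope_ge0 n t : 0 <= slope n t.
Proof. by rewrite mulr_ge0 // huber_slope_ge0. Qed.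

Let height_ge0 n t : 0 <= height n t.
Proof. by rewrite mulr_ge0 // huber_ge0. Qed.

Let adapted_slope n : adp (n * 5).+1 (slope n).
Proof.
apply: (@measurable_funM _ (pastT (info X) _) R); last exact: adapted_C.
apply: (measurableT_comp (@measurable_huber_slope R H)).
exact: adapted_W.
Qed.

Let mheight n : measurable_fun setT (height n).
Proof.
apply: measurable_funM; last exact: measurable_indic.
apply: (measurableT_comp (@measurable_huber R H)).
exact: (adapted_meas (@adapted_W n i)).
Qed.

Let mslope n : measurable_fun setT (slope n).
Proof. exact: (adapted_meas (@adapted_slope n)). Qed.

Let gap_work n t : regular t ->
  huber_gap H (work n i t) <= \sum_j (job_type X n t == j)%:R * gap_size j (sz n j t).
Proof.
move=> _; rewrite /work (bigD1 (job_type X n t)) //= big1 ?addr0; last first.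
  move=> j jt; rewrite /brought (negbTE (_ : _ != j)) ?mul0r //.
  by rewrite eq_sym.
rewrite (bigD1 (job_type X n t)) //= big1 ?addr0; last first.
  by move=> j jt; rewrite (negbTE (_ : _ != j)) ?mul0r // eq_sym.
rewrite eqxx mul1r /gap_size; apply: huber_gap_homo => //.
  by rewrite mulr_ge0.
rewrite ler_wpM2r // /brought eqxx mul1r max_r ?size_pos_ge0 //.
rewrite ler_piMr ?size_pos_ge0 // indicE; by case: (_ \in _).
Qed.

(** Within the cycle this is [huber_step], and killing at its end only lowers the left side. Outside
    the cycle both sides vanish. *)
Let drift_pointwise n t : regular t ->
  height n.+1 t + slope n t * (Num.max 0 (tau n.+1 t) / lam) <=
  height n t +
   (\sum_j slope n t * brought n i j t * (c j / r i j) +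
    (\sum_j \1_(C n) t * (job_type X n t == j)%:R * gap_size j (sz n j t) +
     \1_(C n) t * gap_time (tau n.+1 t))).
Proof.
move=> rt; rewrite max_r ?interarrival_pos_ge0 //.
under eq_bigr do rewrite -mulrA.
under [X in _ + (_ + (X + _))]eq_bigr do rewrite -mulrA.
rewrite -!mulr_sumr -/(work n i t).
have Gw := gap_work n rt.
rewrite /height /slope /gap_time max_r ?interarrival_pos_ge0 // indicE.
have Wn0 := W_ge0 n i t.
have s0 : 0 <= tau n.+1 t / lam by rewrite divr_ge0 ?interarrival_pos_ge0 // ltW.
have step := huber_step H_gt0 Wn0 (work_ge0 n i t) s0; rewrite -regularS // in step.
have hg := huber_ge0 H_gt0 (W_ge0 n.+1 i t).
have [Ct|nCt] := boolP (t \in C n); rewrite indicE ?Ct ?(negbTE nCt) /=.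
  by case: (t \in C n.+1) => /=; lra.
rewrite (_ : t \in C n.+1 = false) ?mulr0 ?mul0r ?addr0 //.
apply/negbTE; apply: contra nCt; rewrite !inE.
exact: no_return_le.
Qed.

(** Mean error per arrival. Every job is charged as if it were sent to server [i], which costs
    nothing since [eps] becomes small with large [H]. *)
Let eps : \bar R := (\sum_j (p j)%:E * \int[lawX j]_x (gap_size j (Num.max 0 x))%:E +
  \int[P]_t (gap_time (tau 0 t))%:E)%E.

Let rho : R := \sum_j w i j * p j * mX j * c j / r i j.

Let integral_tau n : (\int[P]_t (slope n t * (Num.max 0 (tau n.+1 t) / lam))%:E =
  \int[P]_t (slope n t)%:E * (mean_interarrival X / lam)%:E)%E.
Proof.
have mg : measurable_fun [set: R] (fun x : R => Num.max 0 x / lam).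
  by apply: measurable_funM; [exact: measurable_pos|exact: measurable_cst].
have g0 (x : R) : 0 <= Num.max 0 x / lam by rewrite divr_ge0 // ltW.
rewrite (past_interarrival X_law (@adapted_slope n) (slope_ge0 n) mg g0).
congr (_ * _)%E.
under eq_integral do rewrite (max_r (interarrival_pos_ge0 _ _ _)) EFinM.
rewrite ge0_integralZr //.
- by rewrite (interarrival_pos_mean X_law).
- by apply/measurable_EFinP; exact: measurable_interarrival_pos.
- by move=> t _; rewrite lee_fin interarrival_pos_ge0.
- by rewrite lee_fin invr_ge0 ltW.
Qed.

Let slope_brought_ge0 n j t : 0 <= slope n t * brought n i j t.
Proof. exact: mulr_ge0. Qed.

Let slope_load_ge0 n j t : 0 <= slope n t * brought n i j t * (c j / r i j).
Proof. exact: mulr_ge0. Qed.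

Let mbrought n j : measurable_fun setT (brought n i j).
Proof.
apply: measurable_funM; last first.
  exact: (measurableT_comp (measurable_indic (mmark i j))).
apply: measurable_funM; [exact: mtype|exact: measurable_size_pos].
Qed.

Let integral_brought n :
  (\int[P]_t (\sum_j slope n t * brought n i j t * (c j / r i j))%:E <=
   \int[P]_t (slope n t)%:E * rho%:E)%E.
Proof.
under eq_integral do rewrite -sumEFin.
rewrite ge0_integral_sum //; last first.
- by move=> j t _; rewrite lee_fin.
- move=> j; apply/measurable_EFinP; apply: measurable_funM => //.
  exact: measurable_funM.
rewrite /rho -sumEFin ge0_sume_distrr; last first.
  move=> j _; rewrite lee_fin divr_ge0 ?(ltW (r_gt0 _ _)) // !mulr_ge0 // ?ltW //.
  exact: mean_size_gt0.
apply: lee_sum => j _.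
under eq_integral do rewrite EFinM.
rewrite ge0_integralZr //; last first.
- by rewrite lee_fin.
- by move=> t _; rewrite lee_fin.
- by apply/measurable_EFinP; exact: measurable_funM.
have -> : (w i j * p j * mX j * c j / r i j)%:E =
    ((p j)%:E * (mX j)%:E * (w i j)%:E * (c j / r i j)%:E)%E.
  by rewrite -!EFinM; congr _%:E; ring.
rewrite muleA; apply: lee_wpmul2r; first by rewrite lee_fin.
under eq_integral do rewrite /brought !mulrA.
rewrite (past_type_size_mark lawX_mean X_law j (@adapted_slope n) (slope_ge0 n) (mmark i j)).
rewrite !muleA; apply: lee_wpmul2l => //.
apply: mule_ge0; last by rewrite lee_fin ltW // mean_size_gt0.
apply: mule_ge0; last by rewrite lee_fin ltW.
by apply: integral_ge0 => t _; rewrite lee_fin.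
Qed.

(** Stated with sums only: the mean heights are extended reals not yet known to be finite. *)
Let drift n :
  (\int[P]_t (height n.+1 t)%:E +
     \int[P]_t (slope n t)%:E * (mean_interarrival X / lam)%:E <=
   \int[P]_t (height n t)%:E +
     (\int[P]_t (slope n t)%:E * rho%:E + P (C n) * eps))%E.
Proof.
have mF2 : measurable_fun setT (fun t => slope n t * (Num.max 0 (tau n.+1 t) / lam)).
  apply: measurable_funM => //; apply: measurable_funM; last exact: measurable_cst.
  by apply: (measurableT_comp (@measurable_pos R)); exact: measurable_interarrival_pos.
have F20 t : 0 <= slope n t * (Num.max 0 (tau n.+1 t) / lam).
  by rewrite mulr_ge0 // divr_ge0 // ltW.
have mG2 : measurable_fun setT (fun t => \sum_j slope n t * brought n i j t * (c j / r i j)).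
  apply: measurable_sum => j; apply: measurable_funM => //; exact: measurable_funM.
have G20 t : 0 <= \sum_j slope n t * brought n i j t * (c j / r i j).
  exact: sumr_ge0.
have mG3j j : measurable_fun setT
   (fun t => \1_(C n) t * (job_type X n t == j)%:R * gap_size j (sz n j t)).
  apply: measurable_funM.
    by apply: measurable_funM => //; exact: measurable_indic.
  by apply: (measurableT_comp (mgap_size j)); exact: measurable_size_pos.
have G3j0 j t : 0 <= \1_(C n) t * (job_type X n t == j)%:R * gap_size j (sz n j t).
  by rewrite !mulr_ge0.
have mG3 : measurable_fun setT
   (fun t => \sum_j \1_(C n) t * (job_type X n t == j)%:R * gap_size j (sz n j t)).
  exact: measurable_sum.
have G30 t : 0 <= \sum_j \1_(C n) t * (job_type X n t == j)%:R * gap_size j (sz n j t).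
  exact: sumr_ge0.
have mG4 : measurable_fun setT (fun t => \1_(C n) t * gap_time (tau n.+1 t)).
  apply: measurable_funM; first exact: measurable_indic.
  by apply: (measurableT_comp mgap_time); exact: measurable_interarrival_pos.
have G40 t : 0 <= \1_(C n) t * gap_time (tau n.+1 t) by rewrite mulr_ge0.
rewrite -integral_tau -ge0_integralD //; last first.
- exact/measurable_EFinP.
- by move=> t _; rewrite lee_fin.
- exact/measurable_EFinP.
- by move=> t _; rewrite lee_fin.
apply: (@le_trans _ _ (\int[P]_t (height n t +
   (\sum_j slope n t * brought n i j t * (c j / r i j) +
    (\sum_j \1_(C n) t * (job_type X n t == j)%:R * gap_size j (sz n j t) +
     \1_(C n) t * gap_time (tau n.+1 t))))%:E)%E).
  apply: ae_ge0_le_integral => //.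
  - by move=> t _; rewrite adde_ge0 // lee_fin.
  - by apply/measurable_EFinP; exact: measurable_funD.
  - by move=> t _; rewrite lee_fin !addr_ge0.
  - apply/measurable_EFinP; apply: measurable_funD => //.
    by apply: measurable_funD => //; exact: measurable_funD.
  apply: filterS (regular_path_ae r lawX_mean X_law lawS_const lam_gt0 single_policy_static) => t rt _.
  by rewrite lee_fin; exact: drift_pointwise.
under eq_integral do rewrite EFinD.
rewrite ge0_integralD //; last first.
- apply/measurable_EFinP; apply: measurable_funD => //; exact: measurable_funD.
- by move=> t _; rewrite lee_fin !addr_ge0.
- exact/measurable_EFinP.
- by move=> t _; rewrite lee_fin.
apply: leeD2l.
under eq_integral do rewrite EFinD.
rewrite ge0_integralD //; last first.
- apply/measurable_EFinP; exact: measurable_funD.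
- by move=> t _; rewrite lee_fin !addr_ge0.
- exact/measurable_EFinP.
- by move=> t _; rewrite lee_fin.
apply: leeD; first exact: integral_brought.
under eq_integral do rewrite EFinD.
rewrite ge0_integralD //; last first.
- exact/measurable_EFinP.
- by move=> t _; rewrite lee_fin.
- exact/measurable_EFinP.
- by move=> t _; rewrite lee_fin.
have PC : (\int[P]_t (\1_(C n) t)%:E = P (C n))%E by rewrite integral_indic // setIT.
have gs0 j : (0 <= (p j)%:E * \int[lawX j]_x (gap_size j (Num.max 0 x))%:E)%E.
  apply: mule_ge0; first by rewrite lee_fin ltW.
  by apply: integral_ge0 => x _; rewrite lee_fin.
rewrite /eps ge0_muleDr //; last 2 first.
- exact: sume_ge0.
- by apply: integral_ge0 => x _; rewrite lee_fin.
rewrite (past_interarrival X_law (@adapted_C n) (C_ge0 n) mgap_time gap_time_ge0) PC.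
apply: leeD => //.
under eq_integral do rewrite -sumEFin.
rewrite ge0_integral_sum //; last first.
- by move=> j t _; rewrite lee_fin.
- by move=> j; apply/measurable_EFinP.
rewrite ge0_sume_distrr //; apply: lee_sum => j _.
rewrite (past_type_size X_law j (@adapted_C n) (C_ge0 n) (mgap_size j) (gap_size_ge0 j)) PC.
by rewrite muleA.
Qed.

Let z n : R := fine (\int[P]_t (slope n t)%:E).

Let slope_le n t : slope n t <= \1_(C n) t.
Proof. by rewrite ler_piMl // huber_slope_le1. Qed.

Lemma slope_fin n : (\int[P]_t (slope n t)%:E)%E \is a fin_num.
Proof.
rewrite ge0_fin_numE; last by apply: integral_ge0 => t _; rewrite lee_fin.
apply: (@le_lt_trans _ _ (P (C n))); last by rewrite ltey_eq fin_num_measure.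
have PC : (\int[P]_t (\1_(C n) t)%:E = P (C n))%E by rewrite integral_indic // setIT.
rewrite -PC.
apply: ge0_le_integral => //.
- by move=> t _; rewrite lee_fin.
- exact/measurable_EFinP.
- by apply/measurable_EFinP; exact: measurable_indic.
- by move=> t _; rewrite lee_fin.
Qed.

(** When the load [rho] is below the mean gap, this bounds the mean number of arrivals of the cycle
    that find a large workload by a small multiple of the mean number of all its arrivals. *)
Lemma slope_sum_le (eta : R) m : (eps <= eta%:E)%E ->
  (\sum_(n < m) z n) * (mean_interarrival X / lam) <=
  (\sum_(n < m) z n) * rho + (\sum_(n < m) fine (P (C n))) * eta.
Proof.
move=> Heps.
(* The drift telescopes from height 0 at the empty start; the last height stays on the left during
   the induction and is dropped only here. *)
suff : (\int[P]_t (height m t)%:E +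
    ((\sum_(n < m) z n) * (mean_interarrival X / lam))%:E <=
  ((\sum_(n < m) z n) * rho + (\sum_(n < m) fine (P (C n))) * eta)%:E)%E.
  rewrite -lee_fin; apply: le_trans; rewrite leeDr //.
  by apply: integral_ge0 => t _; rewrite lee_fin.
elim: m => [|m IH].
  rewrite !big_ord0 !mul0r !addr0.
  rewrite [leLHS](_ : _ = 0%E) //.
  rewrite (ge0_ae_eq_integral (g := cst 0%E)) ?integral_cst ?mul0e //.
  - exact/measurable_EFinP.
  - by move=> t _; rewrite lee_fin.
  apply: filterS (regular_path_ae r lawX_mean X_law lawS_const lam_gt0 single_policy_static) => t rt _.
  rewrite /height (_ : W 0 i t = 0) ?huber0 ?mul0r //.
  rewrite /workload /= sub0r max_l // oppr_le0.
  by case: rt.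
rewrite !big_ord_recr /= !mulrDl.
have := drift m; rewrite -(fineK (slope_fin m)) -/(z m) => D.
have {}D : (\int[P]_t (height m.+1 t)%:E + (z m * (mean_interarrival X / lam))%:E <=
   \int[P]_t (height m t)%:E + (z m * rho + fine (P (C m)) * eta)%:E)%E.
  apply: le_trans D _; apply: leeD2l; rewrite EFinD; apply: leeD2l.
  by rewrite EFinM fineK ?fin_num_measure // lee_wpmul2l.
rewrite EFinD addeCA addeC; apply: (le_trans (leeD2r _ D)).
rewrite -addeA [X in (_ + X)%E]addeC addeA.
apply: (le_trans (leeD2r _ IH)); rewrite -EFinD lee_fin; lra.
Qed.

End drift.

(** * Choice of the scale and probability of return *)

Let slope i H n t : R := huber_slope H (W n i t) * \1_(C n) t.

(** The error [eps] of the drift at server [i], as a function of the scale [H]. *)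
Let excess i H : \bar R :=
  (\sum_j (p j)%:E * \int[lawX j]_x (huber_gap H (Num.max 0 (Num.max 0 x) * (c j / r i j)))%:E +
  \int[P]_t (huber_gap H (Num.max 0 (tau 0 t) / lam))%:E)%E.

Let near_le (u : nat -> \bar R) (e : R) : u @ \oo --> 0%E -> 0 < e ->
  \forall n \near \oo, (u n <= e%:E)%E.
Proof.
move=> cu e0.
have lt_e : \forall n \near \oo, (u n < e%:E)%E.
  exact: (cu _ (@open_ereal_lt' R 0%E e%:E e0)).
by apply: filterS lt_e => n; exact: ltW.
Qed.

Let excess_near i (e : R) : 0 < e -> \forall n \near \oo, (excess i n.+1%:R <= e%:E)%E.
Proof.
move=> e0; have e20 : 0 < e / 2 by rewrite divr_gt0.
have m0 (x : R) : 0 <= Num.max 0 x by rewrite le_max lexx.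
have mpos := @measurable_pos R.
have near1 : \forall n \near \oo, forall j, (\int[lawX j]_x
    (huber_gap n.+1%:R (Num.max 0 (Num.max 0 x) * (c j / r i j)))%:E <= (e / 2)%:E)%E.
  apply: filter_forall => j; apply: near_le => //.
  apply: huber_gap_integral_cvg.
  - apply: measurable_funM; last exact: measurable_cst.
    by apply: (measurableT_comp mpos).
  - by move=> x; rewrite mulr_ge0.
  under eq_integral do rewrite maxA maxxx EFinM.
  rewrite ge0_integralZr //.
  - by rewrite (mean_sizeE lawX_mean) -EFinM ltry.
  - by apply/measurable_EFinP.
  - by move=> x _; rewrite lee_fin.
  - by rewrite lee_fin.
have near2 : \forall n \near \oo,
    (\int[P]_t (huber_gap n.+1%:R (Num.max 0 (tau 0 t) / lam))%:E <= (e / 2)%:E)%E.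
  apply: near_le => //; apply: huber_gap_integral_cvg.
  - apply: measurable_funM; last exact: measurable_cst.
    by apply: (measurableT_comp mpos); exact: measurable_interarrival_pos.
  - by move=> t; rewrite divr_ge0 // ltW.
  under eq_integral do rewrite (max_r (interarrival_pos_ge0 _ _ _)) EFinM.
  rewrite ge0_integralZr //.
  - by rewrite (interarrival_pos_mean X_law) -EFinM ltry.
  - by apply/measurable_EFinP; exact: measurable_interarrival_pos.
  - by move=> t _; rewrite lee_fin interarrival_pos_ge0.
  - by rewrite lee_fin invr_ge0 ltW.
apply: filterS (filterI near1 near2) => n [n1 n2].
have -> : e = \sum_j p j * (e / 2) + e / 2 by rewrite -mulr_suml p_sum1; field.
rewrite EFinD -sumEFin; apply: leeD => //; apply: lee_sum => j _.
by rewrite EFinM; apply: lee_wpmul2l; [rewrite lee_fin ltW|exact: n1].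
Qed.

Let exists_scale (e : 'I_N -> R) : (forall i, 0 < e i) ->
  exists2 H, 0 < H & forall i, (excess i H <= (e i)%:E)%E.
Proof.
move=> e0.
have : \forall n \near \oo, forall i, (excess i n.+1%:R <= (e i)%:E)%E.
  by apply: filter_forall => i; exact: excess_near.
by move=> /filter_ex[n Hn]; exists n.+1%:R => //; rewrite ltr0n.
Qed.

(** The sizes for all types are bounded at once, so that the event belongs to the size source alone
    and not to the type. *)
Let small_sizes K n : set T := [set t | forall j, job_size X n j t <= K].

Let small_sizes_event K n : generated_by (job_size X n) (small_sizes K n).
Proof.
have -> : small_sizes K n = \bigcap_(j in [set: 'I_M]) (job_size X n j @^-1` `]-oo, K]%classic).
  by apply/seteqP; split=> t /= Ht j; have := Ht j; rewrite ?in_itv //=; apply.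
apply: (@fin_bigcap_measurable _ (g_sigma_algebraType
  [set A | exists k (B : set R), measurable B /\ A = job_size X n k @^-1` B])).
  exact: finite_finset.
by move=> j _; apply: generated_by_preimage; exact: measurable_itv.
Qed.

Let small_sizes_measurable K n : measurable (small_sizes K n).
Proof.
have := @small_sizes_event K n; exact: generated_by_measurable.
Qed.

Let small_sizes_prob : exists2 K, 0 <= K &
  forall n, ((2^-1)%:E <= P (small_sizes K n))%E.
Proof.
pose m := \sum_j mX j.
have m0 : 0 <= m by apply: sumr_ge0 => j _; rewrite ltW // mean_size_gt0.
(* Markov's inequality for the sum of all sizes bounds the complement by [m / (2 * m + 1)]. *)
exists (2 * m + 1); first by lra.
move=> n; pose G := small_sizes (2 * m + 1) n.
have mG : measurable G by exact: small_sizes_measurable.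
have PC1 := probability_setC P mG.
have le1 : ((2 * m + 1)%:E * P (~` G) <= m%:E)%E.
  have -> : m%:E = (\int[P]_t (\sum_j sz n j t)%:E)%E.
    under eq_integral do rewrite -sumEFin.
    rewrite ge0_integral_sum //.
    - by rewrite /m -sumEFin; apply: eq_bigr => j _; rewrite (size_pos_mean lawX_mean X_law).
    - by move=> j; apply/measurable_EFinP; exact: measurable_size_pos.
    - by move=> j t _; rewrite lee_fin size_pos_ge0.
  rewrite -[X in P X]setIT -integral_indic //; last exact: measurableC.
  have k0 : 0 <= 2 * m + 1 by lra.
  have mI : measurable_fun setT (EFin \o (\1_(~` G) : T -> R)).
    by apply/measurable_EFinP; apply: measurable_indic; exact: measurableC.
  have I0 t : setT t -> (0 <= (\1_(~` G) t : R)%:E)%E by rewrite lee_fin indicE.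
  rewrite -(ge0_integralZl_EFin _ measurableT I0 mI k0).
  apply: ge0_le_integral => //.
  - by move=> t _; rewrite mule_ge0 // lee_fin ?indicE //; lra.
  - by apply: emeasurable_funM; [exact: measurable_cst|exact: mI].
  - apply/measurable_EFinP; apply: measurable_sum => j; exact: measurable_size_pos.
  move=> t _; rewrite -EFinM lee_fin indicE.
  have s0 : 0 <= \sum_j sz n j t by apply: sumr_ge0 => j _; exact: size_pos_ge0.
  case: (boolP (t \in ~` G)) => [|_]; last by rewrite mulr0.
  rewrite inE /= => /existsNP[j Hj]; rewrite mulr1.
  apply: (@le_trans _ _ (sz n j t)).
    by rewrite /size_pos le_max; apply/orP; right; rewrite ltW // ltNge; exact/negP.
  by rewrite (bigD1 j) //= lerDl sumr_ge0 // => k _; exact: size_pos_ge0.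
have Gfin : P G \is a fin_num by rewrite fin_num_measure.
move: le1; rewrite PC1 -(fineK Gfin) -EFinB -EFinM !lee_fin.
have : fine (P G) <= 1 by rewrite -lee_fin fineK // probability_le1.
by nra.
Qed.

Let light H n : set T := C n `&` [set t | forall i, W n i t < H].

Let light_event H n : (measurable : set (set (pastT (info X) (n * 5).+1))) (light H n).
Proof.
apply: (@measurableI _ (pastT (info X) _)); first exact: in_cycle_event.
rewrite (_ : [set t | _] = \bigcap_(i in [set: 'I_N]) [set t | W n i t < H]); last first.
  by apply/seteqP; split=> t /= Ht i; have := Ht i; rewrite //=; apply.
apply: fin_bigcap_measurable => [|i _]; first exact: finite_finset.
rewrite -[X in measurable X]setTI.
have aW := @adapted_W n i.
by apply: (@measurable_fun_ltr _ (pastT (info X) _) R setT _ (cst H) _ _ _ [set true]).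
Qed.

Let light_measurable H n : measurable (light H n).
Proof. exact: (past_gen_measurable (info_measurable X_law) (@light_event H n)). Qed.

Let mslope i H n : measurable_fun setT (slope i H n).
Proof.
apply: measurable_funM; last exact: measurable_indic.
apply: (measurableT_comp (@measurable_huber_slope R H)).
exact: (adapted_meas (@adapted_W n i)).
Qed.

(** An arrival of the cycle that is not light finds a workload of at least [H] at some server, where
    the slope is 1. *)
Let light_prob (H : R) n : 0 < H ->
  (P (C n) <= P (light H n) + \sum_i \int[P]_t (slope i H n t)%:E)%E.
Proof.
move=> H0.
have s0 i t : 0 <= slope i H n t by rewrite mulr_ge0 // huber_slope_ge0.
rewrite -[X in (P X <= _)%E]setIT -[X in (_ <= P X + _)%E]setIT -!integral_indic //.
rewrite -ge0_integral_sum //; last first.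
- by move=> i t _; rewrite lee_fin.
- by move=> i; apply/measurable_EFinP.
rewrite -ge0_integralD //; last first.
- by apply: emeasurable_sum => i; apply/measurable_EFinP.
- by move=> t _; apply: sume_ge0 => i _; rewrite lee_fin.
- by apply/measurable_EFinP; exact: measurable_indic.
apply: ge0_le_integral => //.
- by apply/measurable_EFinP; exact: measurable_indic.
- apply: emeasurable_funD; first by apply/measurable_EFinP; exact: measurable_indic.
  by apply: emeasurable_sum => i; apply/measurable_EFinP.
move=> t _; rewrite sumEFin -EFinD lee_fin.
have l0 : 0 <= \1_(light H n) t :> R by rewrite indicE.
have [Ct|nCt] := pselect (C n t); last first.
  by rewrite [leLHS]indicE memNset // addr_ge0 // sumr_ge0.
have [lt|nlt] := pselect (forall i, W n i t < H).
  by rewrite !indicE !mem_set // lerDl sumr_ge0.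
move/existsNP: nlt => [i /negP]; rewrite -leNgt => HW.
rewrite (bigD1 i) //= {1}/slope huber_slope1 // mul1r addrCA lerDl.
by rewrite addr_ge0 // sumr_ge0.
Qed.

(* With small sizes and a long interarrival time all servers clear in one step. *)
Let return_prob (H K b : R) n : 0 < H -> 0 <= K -> 0 < b ->
  (forall i j, K * (c j / r i j) <= b) ->
  (P (light H n) * P (small_sizes K n) * (expR (- (lam * (H + b))))%:E +
    P (C n.+1) <= P (C n))%E.
Proof.
move=> H0 K0 b0 Kb.
have x0 : 0 < lam * (H + b) by rewrite mulr_gt0 // addr_gt0.
rewrite -(past_sizes_tail X_law (@light_event H n) (@small_sizes_event K n) x0).
set D := _ `&` [set t | _ < _].
have mD : measurable D.
  apply: measurableI; first exact: measurableI.
  by rewrite -[X in measurable X]setTI; exact: measurable_fun_ltr.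
rewrite -[X in (P X + _)%E]setIT -[X in (_ + P X <= _)%E]setIT -[X in (_ <= P X)%E]setIT.
rewrite -!integral_indic // -ge0_integralD //; last first.
- by apply/measurable_EFinP; exact: measurable_indic.
- by apply/measurable_EFinP; exact: measurable_indic.
apply: ae_ge0_le_integral => //.
- by move=> t _; rewrite adde_ge0.
- by apply: emeasurable_funD; apply/measurable_EFinP; exact: measurable_indic.
- by apply/measurable_EFinP; exact: measurable_indic.
apply: filterS (regular_path_ae r lawX_mean X_law lawS_const lam_gt0 single_policy_static) => t rt _.
rewrite -EFinD lee_fin.
have [Dt|nDt] := pselect (D t); last first.
  rewrite [X in X + _]indicE memNset // add0r !indicE.
  have [Ct1|nCt1] := pselect (C n.+1 t); last by rewrite memNset.
  by rewrite !mem_set //; exact: no_return_le Ct1.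
have [[Ct Wt] St Tt] : [/\ C n t /\ (forall i, W n i t < H), small_sizes K n t &
    lam * (H + b) < unit_interarrival X n.+1 t] by case: Dt => -[].
rewrite [X in _ + X]indicE memNset ?addr0; last first.
  move=> /(_ n.+1 (ltn0Sn n) (leqnn _)); apply.
  apply: workload0_finds_empty => [m|i].
    by have [_ _ _ It] := rt; rewrite -cards_eq0 It.
  rewrite regularS //; apply: max_l.
  have Tt' : H + b < tau n.+1 t / lam.
    by rewrite ltr_pdivlMr // mulrC (lt_le_trans Tt) // le_max lexx orbT.
  have bt : work n i t <= b.
    rewrite /work (bigD1 (job_type X n t)) //= big1 ?addr0; last first.
      move=> j jt; rewrite /brought (negbTE (_ : _ != j)) ?mul0r //.
      by rewrite eq_sym.
    apply: le_trans (Kb i (job_type X n t)); rewrite ler_wpM2r //.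
    rewrite /brought eqxx mul1r.
    apply: (@le_trans _ _ (sz n (job_type X n t) t)).
      by rewrite ler_piMr ?size_pos_ge0 // indicE; case: (_ \in _).
    by rewrite /size_pos ge_max K0 /=; exact: St.
  by have := Wt i; lra.
by rewrite !indicE !mem_set.
Qed.

(** Let V be the partial sum of the [P (C n)]. At least V / 2 light arrivals are expected, each ends
    the cycle at the next arrival with probability at least [kappa], and a cycle ends at most once;
    so V is at most [2 / kappa], whatever the horizon. *)
Theorem single_policy_stable :
  (forall i, lam * \sum_j w i j * p j * mX j * c j / r i j < mean_interarrival X) ->
  (\int[P]_t cycle t < +oo)%E.
Proof.
move=> load.
pose delta i := mean_interarrival X / lam - \sum_j w i j * p j * mX j * c j / r i j.
have delta0 i : 0 < delta i by rewrite subr_gt0 ltr_pdivlMr // mulrC.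
have N20 : 0 < 2 * N.+1%:R :> R by rewrite mulr_gt0 // ltr0n.
(* The error is the fraction [1 / (2 * N.+1)] of the drift, so that the heavy arrivals of all [N]
   servers together make up at most half; [N.+1] is positive without a case on [N]. *)
have [H H0 HH] := exists_scale (fun i => divr_gt0 (delta0 i) N20).
have [K K0 PK] := small_sizes_prob.
(* Bounds the work of a job of size at most [K] at any server; the added 1 makes it positive. *)
pose b := \sum_i \sum_j K * (c j / r i j) + 1.
have bij i j : 0 <= K * (c j / r i j) by rewrite mulr_ge0.
have Kb i j : K * (c j / r i j) <= b.
  rewrite /b (bigD1 i) //= (bigD1 j) //= -!addrA lerDl !addr_ge0 ?sumr_ge0 //.
  by move=> k _; rewrite sumr_ge0.
have b0 : 0 < b by rewrite ltr_wpDl ?ltr01 // sumr_ge0 // => i _; rewrite sumr_ge0.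
pose v n : R := fine (P (C n)).
have vE n : P (C n) = (v n)%:E by rewrite fineK // fin_num_measure.
have v0 n : 0 <= v n by rewrite fine_ge0.
pose z i n : R := fine (\int[P]_t (slope i H n t)%:E).
have zE i n : (\int[P]_t (slope i H n t)%:E = (z i n)%:E)%E.
  rewrite fineK //; exact: (@slope_fin i H H0 n).
(* Small sizes, with probability at least 1/2, followed by a gap longer than [H + b]. *)
pose kappa := 2^-1 * expR (- (lam * (H + b))).
have kappa0 : 0 < kappa by rewrite mulr_gt0 ?invr_gt0 // expR_gt0.
have drift i m : \sum_(n < m) z i n <= (\sum_(n < m) v n) / (2 * N.+1%:R).
  have L : (\sum_(n < m) z i n) * (mean_interarrival X / lam) <=
      (\sum_(n < m) z i n) * (\sum_j w i j * p j * mX j * c j / r i j) +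
      (\sum_(n < m) v n) * (delta i / (2 * N.+1%:R)).
    exact: (slope_sum_le H0 m (HH i)).
  rewrite -(ler_pM2r (delta0 i)) {1}/delta mulrBr lerBlDl.
  by rewrite (le_trans L) // lerD2l mulrA mulrAC.
have step n : kappa * (v n - \sum_i z i n) <= v n - v n.+1.
  have Lfin : P (light H n) \is a fin_num by rewrite fin_num_measure.
  have := return_prob n H0 K0 b0 Kb; rewrite !vE.
  have := light_prob n H0; rewrite vE.
  under eq_bigr do rewrite zE.
  rewrite sumEFin -(fineK Lfin) -EFinD lee_fin => L1.
  have Sfin : P (small_sizes K n) \is a fin_num by rewrite fin_num_measure.
  have := PK n; rewrite -(fineK Sfin) lee_fin => S1.
  rewrite -!EFinM -EFinD lee_fin => L2.
  have L0 : 0 <= fine (P (light H n)) by rewrite fine_ge0.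
  have E0 := expR_gt0 (- (lam * (H + b))).
  apply: (@le_trans _ _ (kappa * fine (P (light H n)))).
    by rewrite ler_pM2l //; lra.
  have : kappa * fine (P (light H n)) <=
     fine (P (light H n)) * fine (P (small_sizes K n)) * expR (- (lam * (H + b))).
    by rewrite /kappa mulrAC ler_pM2r // mulrC ler_wpM2l.
  by lra.
have telescope m : kappa * (\sum_(n < m) v n - \sum_i \sum_(n < m) z i n) <= 1 - v m.
  elim: m => [|m IH].
    rewrite big_ord0 big1 => [|i _]; last by rewrite big_ord0.
    by rewrite subr0 mulr0 subr_ge0 -lee_fin -vE probability_le1.
  have := step m; move: IH.
  rewrite big_ord_recr /=.
  under [X in _ -> _ -> kappa * (_ - X) <= _]eq_bigr do rewrite big_ord_recr /=.
  rewrite big_split /=; lra.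
have bound m : (\sum_(n < m) P (C n) <= (2 / kappa)%:E)%E.
  under eq_bigr do rewrite vE.
  rewrite sumEFin lee_fin; set V := \sum_(n < m) v n.
  have V0 : 0 <= V by exact: sumr_ge0.
  have zV : \sum_i \sum_(n < m) z i n <= V / 2.
    apply: (@le_trans _ _ (\sum_(i < N) V / (2 * N.+1%:R))).
      by apply: ler_sum => i _; exact: drift.
    rewrite sumr_const card_ord -[leLHS]mulr_natl.
    have N1 : 0 < N.+1%:R :> R by rewrite ltr0n.
    have -> : N%:R * (V / (2 * N.+1%:R)) = V / 2 * (N%:R / N.+1%:R).
      by field; rewrite gt_eqF.
    rewrite ler_piMr ?divr_ge0 // ler_pdivrMr // mul1r ler_nat //.
  rewrite ler_pdivlMr //; have := telescope m; rewrite -/V; have := v0 m.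
  by nra.
have := mean_cycle_length_le lawX_mean X_law lawS_const lam_gt0 single_policy_static bound.
by move=> /le_lt_trans; apply; rewrite ltry.
Qed.

End single_server.

(** * Comparison of the regions *)

Section rebalancing.
Context (R : realType) (N M : nat).
Variables (a : 'I_N -> 'I_M -> R) (kappa : R).
Hypothesis a_ge0 : forall i j, 0 <= a i j.
Hypothesis kappa_gt0 : 0 < kappa.
Hypothesis a_le : forall i k j, a i j <= kappa * a k j.

(* If the total load leaves one server's worth of slack, some server can take a
   fixed fraction of the load of all the others. *)
Lemma rebalance (w : 'I_N -> 'I_M -> R) (L : R) (i0 : 'I_N) :
  (forall i j, 0 <= w i j) -> (forall j, \sum_i w i j = 1) -> 0 <= L ->
  (forall i, \sum_j w i j * a i j <= L) ->
  \sum_i \sum_j w i j * a i j <= N.-1%:R * L ->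
  exists w' : 'I_N -> 'I_M -> R,
  [/\ forall i j, 0 <= w' i j, forall j, \sum_i w' i j = 1 &
      forall i, \sum_j w' i j * a i j <=
        (1 - (N%:R * (1 + kappa * N%:R))^-1) * L].
Proof.
move=> w0 w1 L0 yL ytot; pose y i := \sum_j w i j * a i j.
have N0 : (0 < N)%N by exact: leq_ltn_trans (leq0n i0) (ltn_ord i0).
have Nr1 : 1 <= N%:R :> R by rewrite ler1n.
have N1 : N.-1%:R = N%:R - 1 :> R by rewrite -subn1 natrB.
have [s ys] : exists s, forall i, y s <= y i.
  by case: (@Order.TotalTheory.arg_minP _ _ _ i0 xpredT y) => // s _ Hs; exists s => i; exact: Hs.
have ysN : N%:R * y s <= (N%:R - 1) * L.
  rewrite -N1; apply: le_trans ytot.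
  rewrite mulr_natl -[X in _ *+ X]card_ord -sumr_const.
  by apply: ler_sum => i _; exact: ys.
(* The least loaded server has slack at least [L / N], and a fraction [e] of all jobs costs it at
   most [e * kappa * N * L]. The value of [e] makes its new bound equal to the bound [(1 - e) * L]
   of the other servers. *)
set D := N%:R * _; pose e := D^-1; rewrite -/e.
have kN : 0 <= kappa * N%:R by rewrite mulr_ge0 // ltW.
have D1 : 1 <= D by rewrite /D mulr_ege1 // lerDl.
have D0 : 0 < D by lra.
have e0 : 0 < e by rewrite invr_gt0.
have eD : e * D = 1 by rewrite mulVf // gt_eqF.
have e1 : e <= 1 by rewrite invf_le1.
exists (fun i j => (1 - e) * w i j + (i == s)%:R * e); split.
- by move=> i j; rewrite addr_ge0 ?mulr_ge0 ?subr_ge0 // ltW.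
- move=> j; rewrite big_split /= -mulr_sumr w1 (bigD1 s) //= eqxx big1 => [|i /negbTE ->].
    by rewrite mul1r addr0 mulr1; ring.
  by rewrite mul0r.
move=> i; under eq_bigr do rewrite mulrDl -mulrA.
rewrite big_split /= -mulr_sumr -/(y i); have [->|_] := eqVneq i s; last first.
  rewrite big1 => [|j _]; last by rewrite !mul0r.
  by rewrite addr0 ler_wpM2l ?subr_ge0 //; exact: yL.
under eq_bigr do rewrite mul1r.
rewrite -mulr_sumr.
(* Moving all jobs to [s] multiplies the load of each by at most [kappa], and the total load is at
   most [N * L]. *)
have as_le : \sum_j a s j <= kappa * (N%:R * L).
  apply: (@le_trans _ _ (\sum_j \sum_i w i j * (kappa * a i j))).
    apply: ler_sum => j _; rewrite -[leLHS]mul1r -(w1 j) mulr_suml.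
    by apply: ler_sum => i' _; rewrite ler_wpM2l.
  rewrite exchange_big /=.
  apply: (@le_trans _ _ (\sum_(i' < N) kappa * L)).
    apply: ler_sum => i' _; under eq_bigr do rewrite mulrCA.
    by rewrite -mulr_sumr ler_pM2l // yL.
  by rewrite sumr_const card_ord -[leLHS]mulr_natl mulrCA.
have ys_le : y s <= (1 - N%:R^-1) * L.
  rewrite -(ler_pM2l (_ : 0 < N%:R)) ?ltr0n // (le_trans ysN) //.
  by rewrite mulrA mulrBr mulr1 divff // pnatr_eq0 -lt0n.
have eN : e * (1 + kappa * N%:R) = N%:R^-1.
  by rewrite /e /D invfM -mulrA mulVf ?mulr1 // gt_eqF // ltr_pwDl.
have ys0 : 0 <= y s by apply: sumr_ge0 => j _; rewrite mulr_ge0.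
have : e * (\sum_j a s j) <= e * (kappa * (N%:R * L)) by rewrite ler_pM2l.
have -> : (1 - e) * L = (1 - N%:R^-1) * L + e * (kappa * (N%:R * L)).
  by rewrite -eN; ring.
have : (1 - e) * y s <= y s by rewrite ler_piMl //; lra.
by lra.
Qed.

End rebalancing.

(** * Growth, boundedness and strict inclusion *)

Section regions.
Context (R : realType) (dT : measure_display) (T : measurableType dT).
Variables (P : probability T R) (N M : nat).
Variables (p : 'I_M -> R) (lawX lawS : 'I_M -> probability R R).
Variables (r : 'I_N -> 'I_M -> R) (c : 'I_M -> R) (X : primitives P N M).
Hypothesis p_gt0 : forall j, 0 < p j.
Hypothesis p_sum1 : \sum_(j < M) p j = 1.
Hypothesis r_gt0 : forall i j, 0 < r i j.
Hypothesis lawX_mean : forall j, positive_mean_law (lawX j).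
Hypothesis lawS_mean : forall j, positive_mean_law (lawS j).
Hypothesis X_law : primitives_law X p lawX lawS.
Hypothesis c_ge0 : forall j, 0 <= c j.
Hypothesis lawS_const : forall j, lawS j [set c j] = 1%E.
Variables (i0 : 'I_N) (d : nat).
Hypothesis d_gt1 : (1 < d)%N.

Local Notation mX := (mean_size lawX).
Local Notation mT := (mean_interarrival X).

Let a i j : R := p j * mX j * c j / r i j.

Let aE (w : 'I_N -> 'I_M -> R) i :
  \sum_j w i j * p j * mX j * c j / r i j = \sum_j w i j * a i j.
Proof. by apply: eq_bigr => j _; rewrite /a !mulrA. Qed.

Let a_ge0 i j : 0 <= a i j.
Proof.
rewrite divr_ge0 ?(ltW (r_gt0 _ _)) // !mulr_ge0 // ltW //.
exact: mean_size_gt0.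
Qed.

Let mT_gt0 : 0 < mT.
Proof. exact: (mean_interarrival_gt0 X_law). Qed.

(** A common bound for all ratios of speeds; the sum of the ratios avoids choosing a maximum. *)
Let kappa : R := 1 + \sum_i \sum_k \sum_j r k j / r i j.

Let ratio_ge0 i k j : 0 <= r k j / r i j.
Proof. by rewrite divr_ge0 // ltW. Qed.

Let kappa_gt0 : 0 < kappa.
Proof.
rewrite /kappa ltr_wpDr // sumr_ge0 // => i _; apply: sumr_ge0 => k _.
exact: sumr_ge0.
Qed.

Let a_le i k j : a i j <= kappa * a k j.
Proof.
have -> : a i j = r k j / r i j * a k j.
  by rewrite /a; field; rewrite !gt_eqF.
rewrite ler_wpM2r //; apply: (@le_trans _ _ (\sum_j r k j / r i j)).
  by rewrite (bigD1 j) //= lerDl sumr_ge0.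
apply: (@le_trans _ _ (\sum_k \sum_j r k j / r i j)).
  by rewrite [leRHS](bigD1 k) //= lerDl sumr_ge0 // => k' _; exact: sumr_ge0.
apply: (@le_trans _ _ (\sum_i \sum_k \sum_j r k j / r i j)).
  rewrite [leRHS](bigD1 i) //= lerDl sumr_ge0 // => i' _.
  by apply: sumr_ge0 => k' _; exact: sumr_ge0.
by rewrite /kappa lerDr.
Qed.

Let e : R := (N%:R * (1 + kappa * N%:R))^-1.

Let N_ge1 : 1 <= N%:R :> R.
Proof. by rewrite ler1n (leq_ltn_trans (leq0n i0)). Qed.

Let e_gt0 : 0 < e.
Proof.
have N0 : 0 < N%:R :> R by exact: lt_le_trans N_ge1.
by rewrite invr_gt0 mulr_gt0 // addr_gt0 // mulr_gt0.
Qed.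

Lemma single_region (lam : R) (w : 'I_N -> 'I_M -> R) : 0 < lam ->
  (forall i j, 0 <= w i j) -> (forall j, \sum_i w i j = 1) ->
  (forall i, lam * \sum_j w i j * a i j < mT) -> stability_region X r 1 lam.
Proof.
move=> lam0 w0 w1 load; split; first exact: ltW.
exists (single_policy w); split; first exact: single_policy_static.
right; apply: (single_policy_stable p_gt0 p_sum1 r_gt0 lawX_mean X_law c_ge0
  lawS_const w0 w1 lam0) => i.
by rewrite aE.
Qed.

Let point_mass (i : 'I_N) (j : 'I_M) : R := (i == i0)%:R.

Let point_mass_sum j : \sum_i point_mass i j = 1.
Proof. by rewrite /point_mass (bigD1 i0) //= eqxx big1 ?addr0 // => i /negbTE ->. Qed.

Lemma single_region0 : stability_region X r 1 0.
Proof.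
split=> //; exists (single_policy point_mass); split; last by left.
by apply: single_policy_static => // i j; rewrite /point_mass.
Qed.

Lemma single_region_gt0 : exists2 lam, 0 < lam & stability_region X r 1 lam.
Proof.
pose l := 1 + \sum_i \sum_j a i j.
have l0 : 0 < l by rewrite ltr_wpDr // sumr_ge0 // => i _; exact: sumr_ge0.
exists (mT / l); first by rewrite divr_gt0.
apply: (@single_region _ point_mass) => //.
- by rewrite divr_gt0.
move=> i; rewrite mulrAC ltr_pdivrMr // ltr_pM2l //.
apply: (@le_lt_trans _ _ (\sum_j a i j)).
  by apply: ler_sum => j _; rewrite ler_piMl // /point_mass; case: eqP.
rewrite /l (bigD1 i) //= addrCA ltrDl ltr_wpDr // sumr_ge0 // => k _.
exact: sumr_ge0.
Qed.

Let split_region (lam L : R) : 0 < lam -> stability_region X r d lam -> 1 < L ->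
  exists w : 'I_N -> 'I_M -> R,
  [/\ forall i j, 0 <= w i j, forall j, \sum_i w i j = 1,
      forall i, \sum_j w i j * a i j <= L * mT / lam &
      \sum_i \sum_j w i j * a i j <= N.-1%:R * (L * mT / lam)].
Proof.
move=> lam0 [_ [q [q_static st]]] L1.
have st' : (\int[P]_t cycle_length (arrival_time X lam t) (assigned_set X q t)
    (processing_time X r t) < +oo)%E.
  by case: st => // l0; rewrite l0 ltxx in lam0.
have [w [w0 w1 wl wt]] := replicas_split p_gt0 r_gt0 lawX_mean X_law c_ge0 lawS_const
  lam0 d_gt1 q_static st' i0 L1.
exists w; split => //.
- by move=> i; rewrite -aE ler_pdivlMr // mulrC.
under eq_bigr do rewrite -aE.
by rewrite !mulrA ler_pdivlMr // mulrC.
Qed.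

Lemma replicas_region_grow (lam lam' : R) : 0 < lam -> 0 < lam' ->
  lam' <= (1 + e ^+ 2) * lam -> stability_region X r d lam ->
  stability_region X r 1 lam'.
Proof.
move=> lam0 lam'0 lam'_le reg.
(* The horizon factor is taken as [1 + e] against the gain [1 - e] of rebalancing. This leaves
   [1 - e ^+ 2], and the growth factor [1 + e ^+ 2] still brings the loads below [1 - e ^+ 4]. *)
have L1 : 1 < 1 + e by rewrite ltrDl.
have [w [w0 w1 wl wt]] := split_region lam0 reg L1.
have L0 : 0 <= (1 + e) * mT / lam.
  by rewrite divr_ge0 ?ltW // mulr_gt0 // (lt_trans ltr01).
have [w' [w'0 w'1 w'l]] := rebalance a_ge0 kappa_gt0 a_le i0 w0 w1 L0 wl wt.
apply: (single_region lam'0 w'0 w'1) => i.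
have := w'l i; rewrite -/e; set y := \sum_j _ => yl.
have y0 : 0 <= y by apply: sumr_ge0 => j _; rewrite mulr_ge0.
apply: (@le_lt_trans _ _ ((1 + e ^+ 2) * (lam * y))); first by rewrite mulrA ler_wpM2r.
have lamy : lam * y <= (1 - e ^+ 2) * mT.
  move: yl; rewrite !mulrA ler_pdivlMr // => yl.
  have -> : (1 - e ^+ 2) * mT = (1 - e) * (1 + e) * mT by ring.
  by rewrite mulrC.
have e2 : 0 < e ^+ 2 by rewrite exprn_gt0.
apply: (@le_lt_trans _ _ ((1 + e ^+ 2) * ((1 - e ^+ 2) * mT))).
  by rewrite ler_pM2l // addr_gt0.
rewrite mulrA -subr_gt0.
have -> : mT - (1 + e ^+ 2) * (1 - e ^+ 2) * mT = e ^+ 2 * e ^+ 2 * mT by ring.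
by rewrite !mulr_gt0.
Qed.

Let c_gt0 j : 0 < c j.
Proof.
have [_ /andP[+ _]] := lawS_mean j.
rewrite (_ : (\int[lawS j]_x x%:E)%E = (c j)%:E) ?lte_fin //.
rewrite (_ : (c j)%:E = (\int[lawS j]_x (cst (c j)%:E x))%E); last first.
  by rewrite integral_cst // [X in (_ * X)%E]probability_setT mule1.
apply: ae_eq_integral => //.
exists (~` [set c j]); split; first exact: measurableC.
- have e0 := probability_setC (lawS j) (measurable_set1 (c j)).
  by apply: (etrans e0); rewrite [X in (1 - X)%E]lawS_const subee.
- move=> x /= Hx e'; apply: Hx => _; by rewrite e'.
Qed.

(** However the jobs of one type [j0] are split, their load per arrival is at least
    [a i0 j0 / kappa], which is positive since [c j0] is; the time available per arrival shrinks
    like [1 / lam]. *)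
Lemma replicas_region_bounded : exists b, forall lam,
  stability_region X r d lam -> lam <= b.
Proof.
have j0 : 'I_M.
  case: M p p_sum1 => [p' |m _ _]; last exact: ord0.
  by rewrite big_ord0 => /eqP; rewrite eq_sym oner_eq0.
have a0 : 0 < a i0 j0 / kappa.
  by rewrite divr_gt0 // /a divr_gt0 // !mulr_gt0 // mean_size_gt0.
exists (N.-1%:R * (2 * mT) / (a i0 j0 / kappa)) => lam reg.
have [lam0|lam0] := leP lam 0.
  by rewrite (le_trans lam0) // divr_ge0 ?(ltW a0) // !mulr_ge0 // ltW.
have L1 : 1 < 2 :> R by rewrite ltr1n.
have [w [w0 w1 _ wt]] := split_region lam0 reg L1.
have : a i0 j0 / kappa <= \sum_i \sum_j w i j * a i j.
  rewrite -[leLHS]mul1r -(w1 j0) mulr_suml; apply: ler_sum => i _.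
  rewrite (bigD1 j0) //= ler_wpDr ?sumr_ge0 // => [j _|]; first by rewrite mulr_ge0.
  by rewrite ler_wpM2l // ler_pdivrMr // mulrC.
set b0 := a i0 j0 / kappa in a0 *.
by move=> /le_trans /(_ wt); rewrite mulrA ler_pdivlMr // ler_pdivlMr // mulrC.
Qed.

Lemma replicas_region_proper : stability_region X r d `<` stability_region X r 1.
Proof.
have e2 : 0 < e ^+ 2 by rewrite exprn_gt0.
split.
  move=> lam reg; have [lam0 _] := reg.
  move: lam0; rewrite le_eqVlt => /orP[/eqP <-|lam0]; first exact: single_region0.
  apply: (replicas_region_grow lam0 lam0) => //.
  by apply: ler_peMl; [exact: ltW|rewrite lerDl ltW].
move=> sub; have [lam lam0 reg] := single_region_gt0.
have [b Hb] := replicas_region_bounded.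
(* Under the reverse inclusion each rate reached without replication is again stable with [d]
   replicas and can be raised once more. *)
have grow k : stability_region X r 1 ((1 + e ^+ 2) ^+ k * lam).
  elim: k => [|k IH]; first by rewrite mul1r.
  have l0 k' : 0 < (1 + e ^+ 2) ^+ k' * lam by rewrite mulr_gt0 // exprn_gt0 // addr_gt0.
  apply: (replicas_region_grow (l0 k) (l0 k.+1)); last exact: sub.
  by rewrite exprS mulrA.
(* Bernoulli's inequality makes the geometric growth exceed the bound [b]. *)
have bern (x : R) k : 0 <= x -> 1 + k%:R * x <= (1 + x) ^+ k.
  move=> x0; elim: k => [|k IH]; first by rewrite mul0r addr0.
  rewrite exprS -natr1.
  have : (1 + x) * (1 + k%:R * x) <= (1 + x) * (1 + x) ^+ k.
    by rewrite ler_wpM2l // addr_ge0.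
  have : 0 <= k%:R * (x * x) by rewrite !mulr_ge0.
  by lra.
pose k := Num.bound `|b / (e ^+ 2 * lam)|.
have bk : b < k%:R * (e ^+ 2 * lam).
  rewrite -ltr_pdivrMr ?mulr_gt0 //; apply: le_lt_trans (ler_norm _) _.
  by apply: archi_boundP.
have := Hb _ (sub _ (grow k)); apply/negP; rewrite -ltNge.
apply: (lt_le_trans bk); rewrite mulrA ler_pM2r //.
by apply: le_trans (bern _ k (ltW e2)); rewrite lerDr.
Qed.

End regions.

Theorem theorem1 (R : realType) (dT : measure_display) (T : measurableType dT)
    (P : probability T R) (N M : nat)
    (p : 'I_M -> R) (lawX lawS : 'I_M -> probability R R)
    (r : 'I_N -> 'I_M -> R) (c : 'I_M -> R) (X : primitives P N M)
    (p_gt0 : forall j, 0 < p j)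
    (p_sum1 : \sum_(j < M) p j = 1)
    (r_gt0 : forall i j, 0 < r i j)
    (lawX_mean : forall j, positive_mean_law (lawX j))
    (lawS_mean : forall j, positive_mean_law (lawS j))
    (X_law : primitives_law X p lawX lawS)
    (c_ge0 : forall j, 0 <= c j)
    (lawS_const : forall j, lawS j [set c j] = 1%E) :
  forall d : nat, (1 < d)%N -> (d <= N)%N ->
    stability_region X r d `<` stability_region X r 1.
Proof.
move=> d d1 dN.
have i0 : 'I_N by exact: Ordinal (leq_trans (ltnW d1) dN).
exact: (replicas_region_proper p_gt0 p_sum1 r_gt0 lawX_mean lawS_mean X_law c_ge0
  lawS_const i0 d1).
Qed.
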